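(* Let $\mathcal{P}\in\mathcal{Q}_n$ be an irreducible, combinatorially symmetric sign pattern with a $0$-diagonal whose signed undirected graph $G$ has exactly one cycle $\mathcal{C}=u_1u_2\cdots u_k$, and suppose the distance of $\mathcal{C}$ from every leaf of $G$ is even. Then $\mathcal{P}$ is not consistent if any one of the following holds: (i) $\mathcal{C}$ has at least two nonadjacent positively signed edges; (ii) $\mathcal{C}$ has more than one maximal signed path of odd length; (iii) $k$ is odd and $\mathcal{C}$ has a positively signed edge.
   Context: A sign pattern is a matrix with entries in $\{+,-,0\}$; $\mathcal{Q}_n$ is the set of $n\times n$ sign patterns; $\mathcal{Q}(\mathcal{P})$ is the set of real matrices whose entries have the signs prescribed by $\mathcal{P}=[p_{ij}]$. $\mathcal{P}$ is combinatorially symmetric if $p_{ij}\ne0\iff p_{ji}\neq0$; $0$-diagonal means $p_{ii}=0$. Its signed undirected graph $G$ has vertices $1,\dots,n$, an edge $\{i,j\}$ ($i\neq j$) iff $p_{ij}\ne0$, signed $p_{ij}p_{ji}$. A leaf is a vertex of degree one. $\mathrm{dist}(u,v)$ is the length of a shortest path between $u,v$, and the distance from a vertex $u$ to the cycle $\mathcal{C}$ is $\min_i \mathrm{dist}(u,u_i)$. A maximal signed path of $\mathcal{C}$ is a maximal run of consecutive edges of $\mathcal{C}$ all of the same sign (positive or negative); its length is its number of edges. $\mathcal{P}$ is consistent if there is $k'$ such that every $A\in\mathcal{Q}(\mathcal{P})$ has exactly $k'$ real eigenvalues (with algebraic multiplicity). *)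

(* Defs.v *)
From mathcomp Require Import all_boot all_order all_algebra all_fingroup.
From mathcomp Require Import polyrcf reals.

Set Implicit Arguments.
Unset Strict Implicit.
Unset Printing Implicit Defensive.

Import Order.TTheory GRing.Theory Num.Theory.
Local Open Scope ring_scope.

(* The signs +, -, 0 are encoded as the integers 1, -1, 0, so that products of
   signs are products in int and the sign of a real number is given by sgz. *)
Definition sign_pattern n (P : 'M[int]_n) : Prop :=
  forall i j, P i j \in [:: 1; -1; 0].

Definition qual_class (R : realType) n (P : 'M[int]_n) (A : 'M[R]_n) : Prop :=
  forall i j, sgz (A i j) = P i j.

(* Since char_poly A is monic, rootsR lists each real eigenvalue exactly once;
   mup is its algebraic multiplicity. *)
Definition nb_real_eigenvalues (R : realType) n (A : 'M[R]_n) : nat :=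
  (\sum_(x <- rootsR (char_poly A)) mup x (char_poly A))%N.

Definition consistent (R : realType) n (P : 'M[int]_n) : Prop :=
  exists k' : nat,
    forall A : 'M[R]_n, qual_class P A -> nb_real_eigenvalues A = k'.

(* Permutation similar to [[X, Y], [0, Z]] with X and Z square and nonempty. *)
Definition reducible n (P : 'M[int]_n) : Prop :=
  exists (s : 'S_n) (r : nat), (0 < r < n)%N /\
    forall i j : 'I_n, (r <= i)%N -> (j < r)%N -> P (s i) (s j) = 0.

Definition irreducible_pattern n (P : 'M[int]_n) : Prop := ~ reducible P.

Definition comb_symmetric n (P : 'M[int]_n) : Prop :=
  forall i j, P i j != 0 <-> P j i != 0.

Definition zero_diagonal n (P : 'M[int]_n) : Prop := forall i, P i i = 0.

Section Graph.
Variables (n : nat) (P : 'M[int]_n).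

(* Edges of the graph of P are represented as two-element sets of vertices. *)
Definition adj : rel 'I_n := fun i j => (i != j) && (P i j != 0).

Definition pos_edges : {set {set 'I_n}} :=
  [set [set ij.1; ij.2] |
    ij : 'I_n * 'I_n & adj ij.1 ij.2 && (0 < P ij.1 ij.2 * P ij.2 ij.1)].

Definition neg_edges : {set {set 'I_n}} :=
  [set [set ij.1; ij.2] |
    ij : 'I_n * 'I_n & adj ij.1 ij.2 && (P ij.1 ij.2 * P ij.2 ij.1 < 0)].

Definition leaf (v : 'I_n) : bool := #|[set w | adj v w]| == 1%N.

(* Takes the value n when v is not reachable from u; otherwise it is < n. *)
Definition dist (u v : 'I_n) : nat :=
  \big[minn/n]_(d < n | [exists p : d.-tuple 'I_n,
      [&& path adj u p, uniq (u :: p) & last u p == v]]) d.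

Definition dist_to_cycle (c : seq 'I_n) (u : 'I_n) : nat :=
  \big[minn/n]_(v <- c) dist u v.

Definition graph_cycle (c : seq 'I_n) : Prop := ucycle adj c /\ (3 <= size c)%N.

Definition cycle_edges (c : seq 'I_n) : {set {set 'I_n}} :=
  [set [set x; next c x] | x in c].

(* Two vertex sequences describe the same cycle, up to the choice of starting
   point and direction, exactly when they have the same edges. *)
Definition unique_cycle (c : seq 'I_n) : Prop :=
  graph_cycle c /\ forall c', graph_cycle c' -> cycle_edges c' = cycle_edges c.

(* The l consecutive edges of c following the vertex x. *)
Definition cycle_run (c : seq 'I_n) (x : 'I_n) (l : nat) : {set {set 'I_n}} :=
  [set [set iter j (next c) x; iter j.+1 (next c) x] | j : 'I_l].

Definition signed_run (c : seq 'I_n) (S : {set {set 'I_n}}) : bool :=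
  [exists x in c, exists l : 'I_(size c).+1, (0 < l)%N && (S == cycle_run c x l)]
  && ((S \subset pos_edges) || (S \subset neg_edges)).

(* If all the edges of c have the same sign, the only maximal run is the whole
   of c, which has length size c. *)
Definition maximal_signed_path (c : seq 'I_n) (S : {set {set 'I_n}}) : bool :=
  maxset (signed_run c) S.

End Graph.

(* Main.v *)
Require Import Defs.
From mathcomp Require Import all_boot all_order all_algebra all_fingroup.
From mathcomp Require Import polyrcf reals.
From mathcomp Require Import ring lra zify.
From mathcomp Require boolp classical_sets filter topology normedtype sequences.

Set Implicit Arguments.
Unset Strict Implicit.
Unset Printing Implicit Defensive.

Import Order.TTheory GRing.Theory Num.Theory.
Local Open Scope ring_scope.

(* Let E and O be the vertices off the cycle C at even, resp. odd, distance
   from C.  A vertex off C has at most one neighbour that is not further from C,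
   hence E is only adjacent to O, and the leaf hypothesis provides a matching of
   O into E.  The first fact forces X^m, m = |E| - |O|, to divide the
   characteristic polynomial of every A in Q(P).  Let p be the number of
   positive edges of the matching.

   Having at least N real eigenvalues is a closed condition.  Keeping from P only
   the matching and one orientation of C yields a limit of matrices of Q(P) with
   characteristic polynomial X^m prod (X^2 -+ 1) (X^k + e), e = 1 or -1; so if P
   is consistent with k' real eigenvalues, then k' <= m + 2p + r, where r is the
   number of real roots of X^k + e.  Keeping instead the matching and d disjoint
   positive edges of C, with distinct weights, yields a limit with 2(p + d)
   distinct simple nonzero real eigenvalues, which persist under perturbation,
   so k' >= m + 2p + 2d.  Hence P is not consistent as soon as r < 2d:
   - two disjoint positive edges give d = 2, whereas r <= 2;
   - if k is odd, then r = 1, and one positive edge suffices;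
   - if k is even and (ii) holds without two disjoint positive edges, then
     exactly one edge is positive; the constants e of the two orientations of C
     have product -1, so that one of them gives r = 0. *)

(** * Limits of polynomials with real roots *)

(** Divisibility by N linear factors counts roots with multiplicity, in a form that passes to limits
    of polynomials. *)
Definition has_nroots (R : realType) (N : nat) (p : {poly R}) : Prop :=
  exists2 s : seq R, size s = N & \prod_(z <- s) ('X - z%:P) %| p.

Module RootLimit.
Import boolp classical_sets filter topology normedtype sequences.
Import numFieldNormedType.Exports.
Local Open Scope classical_set_scope.

Section RootLimit.
Variable R : realType.

(** The image filter clusters at some point of the compact segment [-B, B], and an ultrafilter
    converges to each of its cluster points, because it contains every set or its complement. *)
Lemma ultra_bounded_cvg (T : Type) (F : set_system T) (f : T -> R) (B : R) :
  UltraFilter F -> (forall t, `|f t| <= B) -> exists l : R, f @ F --> l.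
Proof.
move=> UF fB.
have PF : ProperFilter F by exact: ultra_proper.
have [|l [_ cl]] := @segment_compact R (- B) B (f @ F) _.
  by apply: (@filterE _ F _ (f @^-1` _)) => t; rewrite /= in_itv /= -ler_norml.
exists l => V Vl.
have [//|FnV] := in_ultra_setVsetC (f @^-1` V) UF.
by have [x [/= nVx Vx]] := cl (~` V) V FnV Vl.
Qed.

(* Along an ultrafilter a bounded root of q converges, so one linear factor at a
   time can be divided out before passing to the limit. *)
Lemma limit_has_nroots (T : Type) (F : set_system T) (B : R) (N d : nat)
    (q : T -> {poly R}) (q0 : {poly R}) :
  UltraFilter F -> (forall t, size (q t) <= d)%N ->
  (forall i, (fun t => (q t)`_i) @ F --> q0`_i) ->
  (forall t, exists2 s : seq R, size s = N /\ (forall z, z \in s -> `|z| <= B)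
     & \prod_(z <- s) ('X - z%:P) %| q t) ->
  has_nroots N q0.
Proof.
move=> UF; elim: N d q q0 => [|N IHN] d q q0 qd qcvg qs.
  by exists [::]; rewrite // big_nil dvd1p.
have /choice[r /choice[q' qE]] : forall t, exists r, exists q',
    [/\ q t = q' * ('X - r%:P), `|r| <= B
      & exists2 s : seq R, size s = N /\ (forall z, z \in s -> `|z| <= B)
        & \prod_(z <- s) ('X - z%:P) %| q'].
  move=> t; have [[|r s] [] //= [sN] sB] := qs t.
  rewrite big_cons => /dvdpP[u ->].
  exists r, (u * \prod_(z <- s) ('X - z%:P)); split.
  - by rewrite mulrAC mulrA.
  - by apply: sB; rewrite mem_head.
  - exists s; last exact: dvdp_mull.
    by split=> // z zs; apply: sB; rewrite inE zs orbT.
have [l rl] := @ultra_bounded_cvg T F r B UF (fun t => let: And3 _ h _ := qE t in h).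
have q'd t : (size (q' t) <= d)%N.
  have [qt _ _] := qE t; have [->|q'0] := eqVneq (q' t) 0; first by rewrite size_poly0.
  apply: leq_trans (qd t); rewrite qt size_Mmonic ?monicXsubC // size_XsubC.
  by rewrite addn2 /=.
have coefE t i : (q' t)`_i = (q t)`_i.+1 + r t * (q' t)`_i.+1.
  have [qt _ _] := qE t.
  by rewrite qt mulrBr coefB coefMX coefMC /= [r t * _]mulrC subrK.
(* By [coefE] each coefficient of the quotient is determined by the next one, and those from index d
   on vanish. The induction therefore runs downwards in i, with m as a bound on d - i. *)
have q'cvg i : exists li : R, (fun t => (q' t)`_i) @ F --> li.
  have [m le_m] : exists m, (d - i <= m)%N by exists (d - i)%N.
  elim: m i le_m => [|m IHm] i.
    rewrite leqn0 subn_eq0 => di; exists 0.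
    rewrite (_ : (fun t => _) = fun=> 0); first exact: cvg_cst.
    by apply: funext => t; rewrite nth_default // (leq_trans (q'd t)).
  move=> le_m; have [|li cvli] := IHm i.+1; first by move: le_m; rewrite !leq_subLR addSnnS.
  exists (q0`_i.+1 + l * li).
  rewrite (_ : (fun t => _) = fun t => (q t)`_i.+1 + r t * (q' t)`_i.+1); last exact: funext.
  by apply: cvgD; [exact: qcvg|exact: cvgM].
have [l' q'l] := choice q'cvg.
pose q0' := \poly_(i < d) l' i.
have q0'E i : q0'`_i = l' i.
  rewrite coef_poly; case: ltnP => // di.
  have h : (fun t => (q' t)`_i) @ F --> (0 : R).
    rewrite (_ : (fun t => _) = fun=> 0); first exact: cvg_cst.
    by apply: funext => t; rewrite nth_default // (leq_trans (q'd t)).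
  have PF : ProperFilter F by exact: ultra_proper.
  exact: (cvg_unique (@norm_hausdorff _ _) h (q'l i)).
have q'cv i : (fun t => (q' t)`_i) @ F --> q0'`_i by rewrite q0'E.
have q0E : q0 = q0' * ('X - l%:P).
  apply/polyP => i; have PF : ProperFilter F by exact: ultra_proper.
  apply: (cvg_unique _ (qcvg i)) => /=; first exact: norm_hausdorff.
  rewrite mulrBr coefB coefMX coefMC.
  rewrite (_ : (fun t => _) =
    fun t => (if i == 0%N then 0 else (q' t)`_i.-1) - (q' t)`_i * r t).
    by apply: cvgB; [case: ifP => _; [exact: cvg_cst|exact: q'cv]|exact: cvgM].
  by apply: funext => t; have [-> _ _] := qE t; rewrite mulrBr coefB coefMX coefMC.
have [s sN sq] := IHN d q' q0' q'd q'cv (fun t => let: And3 _ _ h := qE t in h).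
exists (l :: s); first by rewrite /= sN.
by rewrite big_cons q0E mulrC dvdp_mul.
Qed.

Lemma horner_harmonic_cvg (F : set_system nat) (f : {poly R}) :
  UltraFilter F -> \oo `<=` F -> (fun n => f.[n.+1%:R^-1]) @ F --> f.[0].
Proof.
move=> UF sF.
have h : (fun n : nat => n.+1%:R^-1 : R) @ F --> (0 : R).
  by move=> V /(@cvg_harmonic R) /sF.
elim/poly_ind: f => [|f c IHf].
  rewrite horner0 (_ : (fun n => _) = fun=> 0); first exact: cvg_cst.
  by apply: funext => n; rewrite horner0.
rewrite (_ : (fun n => _) = fun n => f.[n.+1%:R^-1] * n.+1%:R^-1 + c).
  by rewrite hornerMXaddC; apply: cvgD; [exact: cvgM|exact: cvg_cst].
by apply: funext => n; rewrite hornerMXaddC.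
Qed.

End RootLimit.
End RootLimit.

(** * Counting real roots with multiplicity *)

Section RootCount.
Variable R : realType.
Implicit Types (p q : {poly R}) (s : seq R).

(** All real roots are split off explicitly, so that the bounds add up when polynomials are
    multiplied. *)
Definition at_most_nroots (N : nat) p : Prop :=
  exists s q, [/\ p = \prod_(z <- s) ('X - z%:P) * q, forall x, ~~ root q x
                & (size s <= N)%N].

Lemma prod_XsubC_neq0 s : \prod_(z <- s) ('X - z%:P) != 0 :> {poly R}.
Proof. exact/monic_neq0/monic_prod_XsubC. Qed.

Lemma real_root_factorization p : p != 0 ->
  exists s q, p = \prod_(z <- s) ('X - z%:P) * q /\ forall x, ~~ root q x.
Proof.
have [m] := ubnP (size p); elim: m p => // m IHm p; rewrite ltnS => pm p0.
have [rp|nr] := boolp.pselect (exists x, root p x); last first.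
  exists [::], p; rewrite big_nil mul1r; split=> // x; apply/negP => rx.
  by apply: nr; exists x.
have [x /factor_theorem[u pE]] := rp.
have u0 : u != 0 by apply: contraNneq p0 => u0; rewrite pE u0 mul0r.
have [|s [q [uE qN]]] := IHm u _ u0.
  by move: pm; rewrite pE size_Mmonic ?monicXsubC // size_XsubC addn2.
by exists (x :: s), q; rewrite big_cons pE {1}uE mulrC mulrA.
Qed.

Lemma at_most_nroots_size p N : p != 0 -> (size p <= N.+1)%N -> at_most_nroots N p.
Proof.
move=> p0 pN; have [s [q [pE qN]]] := real_root_factorization p0.
exists s, q; split => //.
have q0 : q != 0 by apply: contraNneq p0 => q0; rewrite pE q0 mulr0.
move: pN; rewrite pE size_mul ?prod_XsubC_neq0 // size_prod_XsubC addSn /=.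
move: q0; rewrite -size_poly_gt0; case: (size q) => // k _.
by rewrite addnS ltnS; apply: leq_trans (leq_addr _ _).
Qed.

Lemma at_most_nroots0 p : (forall x, ~~ root p x) -> at_most_nroots 0 p.
Proof. by move=> pN; exists [::], p; rewrite big_nil mul1r. Qed.

Lemma at_most_nrootsM N M p q :
  at_most_nroots N p -> at_most_nroots M q -> at_most_nroots (N + M) (p * q).
Proof.
move=> [s [u [-> uN sN]]] [t [v [-> vN tM]]]; exists (s ++ t), (u * v).
rewrite big_cat /= mulrACA size_cat leq_add //; split=> // x.
by rewrite rootM negb_or uN vN.
Qed.

Lemma at_most_nroots_prod (I : Type) (r : seq I) (Q : pred I) (N : I -> nat)
    (F : I -> {poly R}) :
  (forall i, Q i -> at_most_nroots (N i) (F i)) ->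
  at_most_nroots (\sum_(i <- r | Q i) N i) (\prod_(i <- r | Q i) F i).
Proof.
move=> H; apply: (big_rec2 (fun m p => at_most_nroots m p)).
  by apply: at_most_nroots0 => x; rewrite root1.
by move=> i m p Qi; apply: at_most_nrootsM; apply: H.
Qed.

Lemma mup_rootless (x : R) s q : (forall x, ~~ root q x) ->
  mup x (\prod_(z <- s) ('X - z%:P) * q) = count_mem x s.
Proof. by move=> qN; rewrite mupMl // mu_prod_XsubC. Qed.

Lemma size_sum_count (T : eqType) (s r : seq T) : uniq r -> {subset s <= r} ->
  size s = (\sum_(x <- r) count_mem x s)%N.
Proof.
move=> ur sr; have -> : size s = (\sum_(z <- s) count_mem z r)%N.
  rewrite -sum1_size big_seq [RHS]big_seq; apply: eq_bigr => z zs.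
  by rewrite count_uniq_mem // sr.
under eq_bigr do rewrite -sum1_count big_mkcond.
rewrite exchange_big /=; apply: eq_bigr => x _.
by rewrite -sum1_count [RHS]big_mkcond; apply: eq_bigr => z _; rewrite /= eq_sym.
Qed.

Lemma dvd_prod_count_mem s p (x : R) : p != 0 ->
  \prod_(z <- s) ('X - z%:P) %| p -> (count_mem x s <= mup x p)%N.
Proof.
move=> p0 /dvdpP[u pE]; have u0 : u != 0 by apply: contraNneq p0 => u0; rewrite pE u0 mul0r.
by rewrite pE mupM ?prod_XsubC_neq0 // mu_prod_XsubC leq_addl.
Qed.

Lemma has_nroots_le_sum N p (r : seq R) : p != 0 -> uniq r -> {subset root p <= r} ->
  has_nroots N p -> (N <= \sum_(x <- r) mup x p)%N.
Proof.
move=> p0 ur pr [s <- sp]; rewrite (size_sum_count ur).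
  by apply: leq_sum => x _; apply: dvd_prod_count_mem.
move=> z zs; apply: pr; rewrite -topredE /= -dvdp_XsubCl.
by apply: dvdp_trans sp; rewrite dvdp_XsubCl root_prod_XsubC.
Qed.

Lemma has_nroots_le N M p : p != 0 -> has_nroots N p -> at_most_nroots M p -> (N <= M)%N.
Proof.
move=> p0 Np [t [q [pE qN tM]]]; apply: leq_trans tM.
have ut := undup_uniq t.
apply: leq_trans (has_nroots_le_sum p0 ut _ Np) _ => [x|].
  by rewrite -topredE /= pE rootM (negPf (qN x)) orbF root_prod_XsubC mem_undup.
rewrite (size_sum_count ut) => [|x]; last by rewrite mem_undup.
by rewrite pE; under eq_bigr do rewrite mup_rootless //.
Qed.

Lemma rootsR_uniq p : uniq (rootsR p).
Proof. exact: uniq_roots. Qed.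

Lemma root_rootsR p : p != 0 -> {subset root p <= rootsR p}.
Proof.
by move=> p0 x rx; have /(_ x) := roots_on_rootsR p0; rewrite in_itv /= => <-.
Qed.

(** Together with [nb_real_eigenvalues_ge], this makes the number of real eigenvalues the largest N
    with [has_nroots N]. *)
Lemma has_nb_real_eigenvalues n (A : 'M[R]_n) :
  has_nroots (nb_real_eigenvalues A) (char_poly A).
Proof.
have p0 : char_poly A != 0 by apply/monic_neq0/char_poly_monic.
have [s [q [pE qN]]] := real_root_factorization p0.
exists s; last by rewrite pE dvdp_mulr.
rewrite (size_sum_count (rootsR_uniq (char_poly A))) => [|x xs].
  by apply: eq_bigr => x _; rewrite [in RHS]pE mup_rootless.
apply: root_rootsR p0 _ _.
by rewrite -topredE /= pE rootM root_prod_XsubC xs.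
Qed.

Lemma nb_real_eigenvalues_ge n (A : 'M[R]_n) N :
  has_nroots N (char_poly A) -> (N <= nb_real_eigenvalues A)%N.
Proof.
have p0 : char_poly A != 0 by apply/monic_neq0/char_poly_monic.
exact: has_nroots_le_sum p0 (rootsR_uniq _) (root_rootsR p0).
Qed.

(** As 0 is not in s, ['X^m] is coprime to the product of the factors X - z, so the two divisors
    multiply. *)
Lemma has_nroots_zero_mul m s p : p != 0 -> uniq s -> 0 \notin s -> {in s, forall z, root p z} ->
  'X^m %| p -> has_nroots (m + size s) p.
Proof.
move=> p0 us s0 sp mp; exists (nseq m 0 ++ s); first by rewrite size_cat size_nseq.
rewrite big_cat /= big_nseq subr0 (_ : iter _ _ _ = 'X^m); last first.
  by elim: m {mp} => [|m IHm]; rewrite ?expr0 //= IHm exprS.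
rewrite Gauss_dvdp ?mp /=.
  by apply: uniq_roots_dvdp; [apply/allP|rewrite uniq_rootsE].
apply: coprimep_expl; rewrite coprimep_sym.
have := coprimep_XsubC (\prod_(z <- s) ('X - z%:P)) 0.
by rewrite polyC0 subr0 root_prod_XsubC s0.
Qed.

End RootCount.

(** * Characteristic polynomials of linear matrix pencils *)

Section Pencil.
Variables (R : realType) (n : nat) (A0 A1 : 'M[R]_n).

(** The inner variable is the parameter t: every coefficient, and every value at a fixed y, is a
    polynomial in t. *)
Definition pencil_char_poly : {poly {poly R}} :=
  char_poly (map_mx polyC A0 + 'X *: map_mx polyC A1).

Lemma pencil_char_polyE (t : R) :
  map_poly (horner_eval t) pencil_char_poly = char_poly (A0 + t *: A1).
Proof.
rewrite map_char_poly; congr char_poly; apply/matrixP => i j; rewrite !mxE.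
by rewrite /= /horner_eval !hornerE.
Qed.

Lemma coef_pencil (t : R) i :
  (char_poly (A0 + t *: A1))`_i = (pencil_char_poly`_i).[t].
Proof. by rewrite -pencil_char_polyE coef_map. Qed.

Lemma horner_pencil (t y : R) :
  (char_poly (A0 + t *: A1)).[y] = (pencil_char_poly.[y%:P]).[t].
Proof.
rewrite -pencil_char_polyE.
by rewrite -[in LHS](hornerC y t) -/(horner_eval t y%:P) horner_map.
Qed.

(** Take t = 1/(k+1) along an ultrafilter finer than the filter of k tending to infinity. The
    coefficients converge by continuity of polynomials in t, and the roots remain bounded. *)
Lemma limit_char_poly_has_nroots N :
  (forall t, 0 < t -> has_nroots N (char_poly (A0 + t *: A1))) ->
  has_nroots N (char_poly A0).
Proof.
move=> AN.
have [F [UF sF]] := filter.ultraFilterLemma (filter.eventually_filter).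
pose t k : R := k.+1%:R^-1.
have t_itv k : 0 <= t k <= 1.
  by rewrite invr_ge0 ler0n invf_le1 ?ltr0n // ler1n.
(* [ub i] bounds the i-th coefficient for all t in [0, 1], so Cauchy's bound for monic polynomials
   confines the roots for all k to one interval. *)
pose ub i := sval (poly_itv_bound pencil_char_poly`_i 0 1).
apply: (@RootLimit.limit_has_nroots R nat F (1 + \sum_(i < n.+1) ub i) N n.+1
  (fun k => char_poly (A0 + t k *: A1)) _ UF).
- by move=> k; rewrite size_char_poly.
- move=> i; have := @RootLimit.horner_harmonic_cvg R F pencil_char_poly`_i UF sF.
  by rewrite -coef_pencil scale0r addr0; under boolp.eq_fun do rewrite -coef_pencil.
move=> k; have t0 : 0 < t k by rewrite invr_gt0 ltr0n.
have [s sN sp] := AN _ t0; exists s => //; split=> // z zs.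
have p0 : char_poly (A0 + t k *: A1) != 0 by apply/monic_neq0/char_poly_monic.
have rz : root (char_poly (A0 + t k *: A1)) z.
  by rewrite -dvdp_XsubCl; apply: dvdp_trans sp; rewrite dvdp_XsubCl root_prod_XsubC.
apply: le_trans (ltW (cauchy_boundP p0 (eqP rz))) _.
rewrite /cauchy_bound (eqP (char_poly_monic _)) normr1 invr1 mul1r lerD2l size_char_poly.
apply: ler_sum => i _; rewrite coef_pencil; exact: (svalP (poly_itv_bound _ 0 1)).
Qed.

Lemma exists_small_pos (s : seq R) : exists2 t, 0 < t & {in s, forall z, 0 < z -> t < z}.
Proof.
elim: s => [|x s [t t0 ts]]; first by exists 1.
have [x0|x0] := ltP 0 x; last first.
  exists t => // z; rewrite inE => /orP[/eqP->|/ts//].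
  by rewrite ltNge x0.
exists (Num.min t x / 2); first by rewrite divr_gt0 // lt_min t0 x0.
have h : Num.min t x / 2 < Num.min t x by rewrite ltr_pdivrMr // ltr_pMr ?ltr1n // lt_min t0 x0.
move=> z; rewrite inE => /orP[/eqP->|zs z0].
  by move=> _; apply: lt_le_trans h _; rewrite ge_min lexx orbT.
by apply: lt_trans (ts z zs z0); apply: lt_le_trans h _; rewrite ge_min lexx.
Qed.

(** For fixed y the value is a polynomial in t that is nonzero at 0. If t lies below all its
    positive roots, the intermediate value theorem forbids a change of sign on [0, t]; finitely many
    y leave room for a common t. *)
Lemma pencil_same_sign (ys : seq R) :
  {in ys, forall y, (char_poly A0).[y] != 0} ->
  exists2 t, 0 < t & {in ys, forall y,
    0 < (char_poly A0).[y] * (char_poly (A0 + t *: A1)).[y]}.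
Proof.
move=> yN; pose f y := pencil_char_poly.[y%:P].
have [t t0 tP] := exists_small_pos (flatten [seq rootsR (f y) | y <- ys]).
exists t => // y yys.
have f0 : (f y).[0] = (char_poly A0).[y] by rewrite -horner_pencil scale0r addr0.
have fN : f y != 0 by apply: contraNneq (yN y yys) => fy; rewrite -f0 fy horner0.
rewrite (horner_pencil t y) -f0 -/(f y) ltNge; apply/negP => le0.
have [z /itvP zI rz] := polyrcf.poly_ivt (ltW t0) le0.
have [z0 zt] : 0 <= z /\ z <= t by rewrite !zI.
have zN : z != 0 by apply: contraTneq rz => ->; rewrite /root f0 yN.
have := tP z; rewrite lt_neqAle eq_sym zN z0 ltNge zt.
have -> : z \in flatten [seq rootsR (f y0) | y0 <- ys]; last by move=> /(_ isT isT).
by apply/flattenP; exists (rootsR (f y)); [exact: map_f|exact: root_rootsR].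
Qed.

End Pencil.

(** * Determinants of block and sparse matrices *)

Section RowRestriction.
Variables (K : comNzRingType) (n : nat).
Implicit Types (M : 'M[K]_n) (S T : {set 'I_n}).

(** The determinant of this matrix is the principal minor of M on S. Keeping the size n avoids any
    reindexing of blocks. *)
Definition row_restrict S M : 'M[K]_n :=
  \matrix_(i, j) (if i \in S then M i j else (i == j)%:R).

(* Under the vanishing hypothesis row_restrict S M *m row_restrict T M is
   row_restrict (S :|: T) M. *)
Lemma det_row_restrictU M S T : [disjoint S & T] ->
  {in S & T, forall i j, M i j = 0} ->
  \det (row_restrict (S :|: T) M) =
  \det (row_restrict S M) * \det (row_restrict T M).
Proof.
move=> dST M0; rewrite -det_mulmx; congr (\det _).
apply/matrixP => i j; rewrite !mxE in_setU.
have [iS|iNS] /= := boolP (i \in S).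
  rewrite (bigD1 j) //= big1 ?addr0 => [|k kj]; rewrite !mxE iS.
    by have [jT|jNT] := boolP (j \in T); [rewrite M0 ?mul0r|rewrite eqxx mulr1].
  by have [kT|kNT] := boolP (k \in T); [rewrite M0 ?mul0r|rewrite (negPf kj) mulr0].
rewrite (bigD1 i) //= big1 ?addr0 => [|k ki]; rewrite !mxE (negPf iNS).
  by rewrite eqxx mul1r.
by rewrite eq_sym (negPf ki) mul0r.
Qed.

Lemma row_restrictT M : row_restrict [set: 'I_n] M = M.
Proof. by apply/matrixP => i j; rewrite mxE inE. Qed.

Lemma row_restrict0 M : row_restrict set0 M = 1%:M.
Proof. by apply/matrixP => i j; rewrite !mxE inE. Qed.

Lemma det_row_restrict_diag M S :
  {in S, forall i j, j != i -> M i j = 0} ->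
  \det (row_restrict S M) = \prod_(i in S) M i i.
Proof.
move=> M0; have -> : row_restrict S M = diag_mx (\row_i (if i \in S then M i i else 1)).
  apply/matrixP => i j; rewrite !mxE; case: ifPn => iS.
    by have [->|ji] := eqVneq i j; rewrite ?mulr1n // mulr0n M0 // eq_sym.
  by case: eqP.
by rewrite det_diag [RHS]big_mkcond; apply: eq_bigr => i _; rewrite mxE.
Qed.

(** The condition on Z says that s is a single cycle on S. A permutation u with nonzero Leibniz term
    sends each i of S to i or to [s i], and fixes the rest; the set of points it moves is stable
    under s, so u is the identity or s. *)
Lemma det_row_restrict_cycle M S (s : 'S_n) : S != set0 ->
  {in S, forall i, s i != i} ->
  (forall i, i \notin S -> s i = i) ->
  (forall Z : {set 'I_n}, Z \subset S -> Z != set0 -> {in Z, forall i, s i \in Z} -> Z = S) ->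
  {in S, forall i j, j != i -> j != s i -> M i j = 0} ->
  \det (row_restrict S M) =
  \prod_(i in S) M i i + (-1) ^+ s * \prod_(i in S) M i (s i).
Proof.
move=> /set0Pn[x xS] sS sNS Smin M0.
have s1 : s != 1%g.
  by apply: contraTneq (sS x xS) => ->; rewrite perm1 eqxx.
rewrite /determinant (bigD1 1%g) //= (bigD1 s) //= [X in _ + (_ + X)]big1 ?addr0 => [|u /andP[u1 us]].
  rewrite odd_perm1 expr0 mul1r; congr (_ + _ * _).
    rewrite [RHS]big_mkcond; apply: eq_bigr => i _; rewrite mxE perm1 eqxx.
    by case: ifP.
  rewrite [RHS]big_mkcond; apply: eq_bigr => i _; rewrite mxE.
  by case: ifPn => // /sNS ->; rewrite eqxx.
suff /existsP[i /eqP Mi] : [exists i, row_restrict S M i (u i) == 0].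
  by rewrite (bigD1 i) //= Mi mul0r mulr0.
apply: contraT; rewrite negb_exists => /forallP uN.
have uNS i : i \notin S -> u i = i.
  by move=> iS; have := uN i; rewrite mxE (negPf iS); case: (eqVneq i (u i)) => [//|_]; rewrite eqxx.
have uS i : i \in S -> u i = i \/ u i = s i.
  move=> iS; have := uN i; rewrite mxE iS => Mi.
  have [->|ui] := eqVneq (u i) i; first by left.
  have [->|us'] := eqVneq (u i) (s i); first by right.
  by rewrite M0 ?eqxx in Mi.
(* Stability of Z under s: if u fixed [s i] while [u i = s i], injectivity of u would give
   [s i = i]. *)
pose Z := [set i in S | u i != i].
have ZS : Z = S.
  apply: Smin.
  - by apply/subsetP => i; rewrite inE => /andP[].
  - apply: contraNneq u1 => Z0; apply/eqP/permP => i; rewrite perm1.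
    have [iS|/uNS//] := boolP (i \in S); apply/eqP; apply: contraT => ui.
    by have : i \in Z; [rewrite inE iS|rewrite Z0 inE].
  move=> i; rewrite !inE => /andP[iS ui].
  have uis : u i = s i by have [uii|] := uS i iS; rewrite ?uii ?eqxx // in ui *.
  have siS : s i \in S.
    by apply: contraT => h; have := sNS _ h => /perm_inj sii; rewrite sii iS in h.
  rewrite siS /=; apply: contraNneq ui; rewrite -{2}uis => /perm_inj.
  by rewrite uis => ->; rewrite eqxx.
case/negP: us; apply/eqP/permP => i; have [iS|iS] := boolP (i \in S); last by rewrite uNS ?sNS.
have [ui|//] := uS i iS.
by have := iS; rewrite -ZS inE ui eqxx andbF.
Qed.

Lemma det_row_restrict_pair M x y : x != y ->
  (forall j, j != x -> j != y -> M x j = 0) ->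
  (forall j, j != x -> j != y -> M y j = 0) ->
  \det (row_restrict [set x; y] M) = M x x * M y y - M x y * M y x.
Proof.
move=> xy Mx My.
rewrite (@det_row_restrict_cycle _ _ (tperm x y)).
- rewrite odd_tperm xy expr1 mulN1r !big_setU1 ?inE //= !big_set1.
  by rewrite tpermL tpermR.
- by apply/set0Pn; exists x; rewrite !inE eqxx.
- by move=> i; rewrite !inE => /orP[]/eqP->; rewrite ?tpermL ?tpermR // eq_sym.
- by move=> i; rewrite !inE negb_or => /andP[ix iy]; rewrite tpermD // eq_sym.
- move=> Z Zxy /set0Pn[z zZ] Zt.
  have [xZ yZ] : x \in Z /\ y \in Z.
    have := subsetP Zxy z zZ; rewrite !inE => /orP[]/eqP zE; rewrite zE in zZ.
      by split=> //; have := Zt x zZ; rewrite tpermL.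
    by split=> //; have := Zt y zZ; rewrite tpermR.
  by apply/eqP; rewrite eqEsubset Zxy; apply/subsetP => i; rewrite !inE => /orP[]/eqP->.
- move=> i; rewrite !inE => /orP[]/eqP-> j; rewrite ?tpermL ?tpermR => jx jy.
    exact: Mx.
  exact: My.
Qed.

(** The pairs {x, g x} are disjoint and their rows vanish outside the pair, so they split off one at
    a time as 2 by 2 minors. *)
Lemma det_row_restrict_pairs M (Q : {set 'I_n}) (g : 'I_n -> 'I_n) :
  {in Q &, injective g} -> {in Q, forall x, g x \notin Q} ->
  {in Q, forall x j, j != x -> j != g x -> M x j = 0 /\ M (g x) j = 0} ->
  \det (row_restrict (Q :|: g @: Q) M) =
  \prod_(x in Q) (M x x * M (g x) (g x) - M x (g x) * M (g x) x).
Proof.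
have [m] := ubnP #|Q|; elim: m Q => // m IHm Q; rewrite ltnS => Qm ginj gQ M0.
have [->|/set0Pn[x xQ]] := eqVneq Q set0.
  by rewrite imset0 setU0 row_restrict0 det1 big_set0.
pose Q' := Q :\ x.
have Q'Q : {subset Q' <= Q} by move=> i; rewrite inE => /andP[].
have xgx : x != g x by apply: contraNneq (gQ x xQ) => <-.
have gxN y : y \in Q -> y != x -> g y != g x.
  by move=> yQ; apply: contraNneq => /ginj-> //.
have -> : Q :|: g @: Q = [set x; g x] :|: (Q' :|: g @: Q').
  rewrite -(setD1K xQ) -/Q' imsetU1 -!setUA; congr (_ :|: _).
  by rewrite setUCA.
rewrite det_row_restrictU.
- rewrite det_row_restrict_pair // => [|j jx jg|j jx jg]; try by have [] := M0 x xQ j jx jg.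
  rewrite IHm.
  + by rewrite [RHS](bigD1 x) //=; congr (_ * _); apply: eq_bigl => i; rewrite !inE andbC.
  + by move: Qm; rewrite (cardsD1 x Q) xQ.
  + by move=> i j /Q'Q iQ /Q'Q jQ; apply: ginj.
  + by move=> i /Q'Q iQ; apply: contra (gQ i iQ) => /Q'Q.
  + by move=> i /Q'Q; apply: M0.
- rewrite disjoint_sym disjoints_subset; apply/subsetP => i; rewrite !inE negb_or.
  case/orP=> [/andP[ix iQ]|/imsetP[y]].
    by rewrite ix; apply: contraTneq iQ => ->; apply: gQ.
  rewrite !inE => /andP[yx yQ] ->; rewrite gxN // andbT.
  by apply: contraTneq xQ => <-; apply: gQ.
- move=> i j; rewrite !inE => ixg jQ.
  have [jx jgx] : j != x /\ j != g x.
    case/orP: jQ => [/andP[jx jQ]|/imsetP[y]].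
      by split=> //; apply: contraTneq jQ => ->; apply: gQ.
    rewrite !inE => /andP[yx yQ] ->; rewrite gxN //; split=> //.
    by apply: contraTneq xQ => <-; apply: gQ.
  by have [] := M0 x xQ j jx jgx; case/orP: ixg => /eqP->.
Qed.

End RowRestriction.

(* In each term of the Leibniz formula at most #|O| indices of E are moved into O;
   the others are fixed and contribute a factor 'X. *)
Lemma Xn_dvd_char_poly (F : fieldType) n (A : 'M[F]_n) (E O : {set 'I_n}) :
  [disjoint E & O] -> {in E, forall i j, A i j != 0 -> j \in O} ->
  'X^(#|E| - #|O|) %| char_poly A.
Proof.
move=> dEO EO; rewrite /char_poly /determinant.
apply: (big_ind (fun p => 'X^(#|E| - #|O|) %| p)) => [|p q|s _].
- exact: dvdp0.
- exact: dvdp_add.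
apply: dvdp_mull.
have [[i]|sN] := boolp.pselect (exists i, char_poly_mx A i (s i) = 0).
  by move=> Ai; rewrite (bigD1 i) //= Ai mul0r dvdp0.
pose Z := [set i in E | s i == i].
have leZ : (#|E| - #|O| <= #|Z|)%N.
  rewrite leq_subLR -(cardsID [set i | s i == i] E) addnC.
  rewrite (_ : E :&: _ = Z) ?leq_add2r; last by apply/setP => i; rewrite !inE.
  rewrite -(card_imset _ (@perm_inj _ s)); apply: subset_leq_card.
  apply/subsetP => j /imsetP[i]; rewrite !inE => /andP[sii iE] ->.
  apply: (EO i iE); apply/eqP => Ai; apply: sN; exists i.
  by rewrite !mxE Ai eq_sym (negPf sii) mulr0n subr0.
rewrite (bigID (mem Z)) /=; apply: dvdp_mulr.
rewrite (eq_bigr (fun=> 'X)) => [|i]; first by rewrite prodr_const dvdp_exp2l.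
rewrite inE => /andP[iE /eqP->]; rewrite !mxE eqxx.
have -> : A i i = 0.
  apply/eqP; apply: contraT => /(EO i iE) iO.
  by have := disjointFr dEO iE; rewrite iO.
by rewrite mulr1n subr0.
Qed.

Lemma char_poly_mx_offdiag (F : fieldType) n (A : 'M[F]_n) i j : i != j ->
  char_poly_mx A i j = - (A i j)%:P.
Proof. by move=> ij; rewrite !mxE (negPf ij) mulr0n sub0r. Qed.

Lemma char_poly_mx_diag (F : fieldType) n (A : 'M[F]_n) i : A i i = 0 ->
  char_poly_mx A i i = 'X.
Proof. by move=> Ai; rewrite !mxE eqxx Ai mulr1n subr0. Qed.

(** * The graph of the pattern *)

Section BigMinn.
Variables (I : eqType) (m : nat) (Q : pred I) (F : I -> nat).

Lemma bigminn_le (r : seq I) x : x \in r -> Q x ->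
  (\big[minn/m]_(i <- r | Q i) F i <= F x)%N.
Proof.
elim: r => // y r IHr; rewrite inE big_cons => /orP[/eqP<- ->|xr Qx].
  exact: geq_minl.
by case: ifP => _; [apply: leq_trans (geq_minr _ _) _|]; apply: IHr.
Qed.

Lemma bigminn_attained (r : seq I) : (\big[minn/m]_(i <- r | Q i) F i < m)%N ->
  exists x, [/\ x \in r, Q x & \big[minn/m]_(i <- r | Q i) F i = F x].
Proof.
elim: r => [|y r IHr]; rewrite ?big_nil ?ltnn // big_cons.
case: ifP => [Qy|_]; last first.
  by move=> /IHr[x [xr Qx ->]]; exists x; rewrite inE xr orbT.
case: (leqP (F y) (\big[minn/m]_(i <- r | Q i) F i)) => [_ _|_ /IHr[x [xr Qx ->]]].
  by exists y; rewrite mem_head.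
by exists x; rewrite inE xr orbT.
Qed.
End BigMinn.

Section Graph.
Variables (n : nat) (P : 'M[int]_n) (c : seq 'I_n).
Hypothesis P_irr : irreducible_pattern P.
Hypothesis P_sym : comb_symmetric P.
Hypothesis P_diag : zero_diagonal P.
Hypothesis c_unique : unique_cycle P c.
Hypothesis c_leaf : forall v : 'I_n, leaf P v -> ~~ odd (dist_to_cycle P c v).

Local Notation e := (adj P).
Local Notation depth := (dist_to_cycle P c).

Lemma adj_sym : symmetric e.
Proof. by move=> i j; rewrite /adj eq_sym; congr andb; apply/idP/idP => /P_sym. Qed.

Lemma adj_neq0 i j : P i j != 0 -> e i j.
Proof. by move=> Pij; rewrite /adj Pij andbT; apply: contraNneq Pij => ->; rewrite P_diag. Qed.

(** Otherwise, listing the vertices reachable from u before all others gives a permutation that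
    exhibits a zero block, and P is reducible. *)
Lemma irreducible_connect u v : connect e u v.
Proof.
apply: contraT => uv; case: P_irr.
pose S := [set w | connect e u w].
have uS : u \in S by rewrite inE connect0.
have vS : v \notin S by rewrite inE.
pose l := enum S ++ enum (~: S).
have sl : size l = n by rewrite size_cat -!cardE cardsC card_ord.
have ul : uniq l.
  rewrite cat_uniq !enum_uniq andbT /=; apply/hasPn => x.
  by rewrite !mem_enum inE.
have f_inj : injective (fun i : 'I_n => nth u l i).
  by move=> i j /eqP; rewrite nth_uniq ?sl // => /eqP/val_inj.
exists (perm f_inj), #|S|; split.
  apply/andP; split; first by apply/card_gt0P; exists u.
  rewrite -[X in (_ < X)%N](card_ord n) -(cardsC S) -[X in (X < _)%N]addn0 ltn_add2l.
  by apply/card_gt0P; exists v; rewrite inE.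
move=> i j Si jS; rewrite !permE !nth_cat -cardE jS ltnNge Si /=.
apply/eqP; apply: contraT => /P_sym/adj_neq0 eij.
have jS' : nth u (enum S) j \in S by rewrite -mem_enum mem_nth // -cardE.
have : nth u (enum (~: S)) (i - #|S|) \in ~: S.
  by rewrite -mem_enum mem_nth // -cardE ltn_subLR // cardsC card_ord.
by rewrite inE !inE (connect_trans _ (connect1 eij)) // -[connect _ _ _]in_set.
Qed.

(** [dist] minimizes over simple paths of length below n, so the walk is first shortened to a simple
    one. *)
Lemma depth_le u p : path e u p -> last u p \in c -> (depth u <= size p)%N.
Proof.
case/shortenP => p' p'_path p'_uniq /= sub last_c.
have le_p : (size p' <= size p)%N by apply: uniq_leq_size => //; case/andP: p'_uniq.
apply: leq_trans le_p.
have p'n : (size p' < n)%N by have := max_card (mem (u :: p')); rewrite (card_uniqP p'_uniq) card_ord.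
apply: (@leq_trans (dist P u (last u p'))).
  by rewrite /dist_to_cycle; apply: (@bigminn_le _ n xpredT (dist P u)).
apply: (@bigminn_le _ n _ (fun d : 'I_n => val d) _ (Ordinal p'n)); first exact: mem_index_enum.
by apply/existsP; exists (in_tuple p'); rewrite p'_path p'_uniq /= eqxx.
Qed.

Lemma cycle_nonempty : exists x, x \in c.
Proof. by have [[_]] := c_unique; case: c => // x s _ _; exists x; rewrite mem_head. Qed.

Lemma depth_path u : exists p, [/\ path e u p, last u p \in c & size p = depth u].
Proof.
have [x xc] := cycle_nonempty.
have /connectP[p pp px] := irreducible_connect u x.
(* Connectedness keeps the value below the default n, so both minima are attained by an actual
   path. *)
have : (depth u < n)%N.
  move: xc; rewrite px; case/shortenP: pp => p' pp' up' _ xc.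
  apply: leq_ltn_trans (depth_le pp' xc) _.
  by have := max_card (mem (u :: p')); rewrite (card_uniqP up') card_ord.
move=> dn; have [v [vc _ dE]] := bigminn_attained dn.
rewrite [depth u]dE; have dn' : (dist P u v < n)%N by rewrite -dE.
have [d [_ dP dE']] := bigminn_attained dn'; rewrite [dist _ _ _]dE'.
have /existsP[q /and3P[qp _ /eqP qv]] := dP.
by exists q; rewrite qv size_tuple.
Qed.

Lemma depth_eq0 v : (depth v == 0%N) = (v \in c).
Proof.
apply/eqP/idP => [d0|vc]; last by apply/eqP; rewrite -leqn0; apply: (@depth_le v [::]).
by have [[|w p] [_ vc pd]] := depth_path v; rewrite ?d0 in pd *.
Qed.

Lemma depth_parent v : v \notin c -> exists2 w, e v w & depth v = (depth w).+1.
Proof.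
move=> vc; have [[|w p] [/= pp pc pd]] := depth_path v; first by rewrite pc in vc.
case/andP: pp => vw pp; exists w => //; apply/eqP; rewrite eqn_leq.
rewrite -pd [X in _ && X]ltnS depth_le // andbT pd.
have [q [qp qc <-]] := depth_path w.
by apply: (@depth_le v (w :: q)) => //=; rewrite vw.
Qed.

(* Two such neighbours would be joined through the cycle by a path avoiding v,
   and hence v would lie on a cycle. *)
Lemma lower_neighbor_unique v w w' : v \notin c -> e v w -> e v w' ->
  (depth w <= depth v)%N -> (depth w' <= depth v)%N -> w = w'.
Proof.
move=> vc vw vw' dw dw'; apply/eqP; apply: contraT => ww'.
have [[/andP[c_cycle c_uniq] c3] c_only] := c_unique.
pose e' := [rel x y | [&& e x y, x != v & y != v]].
have e'_sym : symmetric e' by move=> x y; rewrite /= adj_sym andbA andbAC -andbA.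
(* A shortest path from x to the cycle avoids v: its part after v would have length at least
   [depth v], hence at least [depth x], yet it is strictly shorter than the whole path. *)
have to_cycle x : e v x -> (depth x <= depth v)%N -> exists2 z, z \in c & connect e' x z.
  move=> vx dx; have [p [pp pc pd]] := depth_path x.
  have vp : v \notin x :: p.
    rewrite inE negb_or; apply/andP; split.
      by apply: contraTneq vx => ->; rewrite /adj eqxx.
    apply/negP => vp; case/splitPr: vp pp pc pd => p1 p2.
    rewrite cat_path last_cat size_cat /= => /and3P[_ _ pp2] pc pd.
    have := leq_trans dx (depth_le pp2 pc); rewrite -pd addnS.
    by rewrite ltnNge leq_addl.
  exists (last x p) => //; apply/connectP; exists p => //.
  apply: (sub_in_path (P := [pred y | y != v]) (e := e)) pp => [y y' /= yv y'v ->|].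
    by move: yv y'v; rewrite !inE => -> ->.
  by apply/allP => y yxp /=; apply: contraNneq vp => <-.
have [z zc wz] := to_cycle w vw dw.
have [z' zc' wz'] := to_cycle w' vw' dw'.
have c_cycle' : path.cycle e' c.
  apply: (sub_in_cycle (P := [pred y | y != v]) (e := e)) c_cycle => [y y' /= yv y'v ->|].
    by move: yv y'v; rewrite !inE => -> ->.
  by apply/allP => y yxp /=; apply: contraNneq vc => <-.
have : connect e' w w'.
  apply: connect_trans wz _; apply: connect_trans (connect_cycle c_cycle' zc zc') _.
  by rewrite (sym_connect_sym e'_sym).
case/connectP => p pp w'E; move: ww' vw'; rewrite w'E; case/shortenP: pp => p' pp' up' _ ww' vw'.
have vp' : v \notin w :: p'.
  rewrite inE negb_or; apply/andP; split.
    by apply: contraTneq vw => ->; rewrite /adj eqxx.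
  elim: (p') (w) pp' {up' ww' vw' w'E vw dw wz} => //= y s IHs x /andP[/and3P[_ _ yv] /IHs].
  by rewrite inE negb_or eq_sym yv.
have pp'' : path e w p' by apply: sub_path pp' => x y /= /and3P[].
(* Joining v to both ends of the simple path from w to w' closes a cycle through v. By uniqueness
   its edges are those of c, although v is not on c. *)
have C' : graph_cycle P (v :: w :: p').
  split.
    rewrite /ucycle /= vw rcons_path pp'' /= adj_sym vw' /=.
    by rewrite vp' -[_ && _]/(uniq (w :: p')) up'.
  by case: (p') ww' => //=; rewrite eqxx.
have : [set v; next (v :: w :: p') v] \in cycle_edges c.
  by rewrite -(c_only _ C'); apply/imsetP; exists v; rewrite // mem_head.
case/imsetP => x xc /setP/(_ v); rewrite !inE eqxx /= => /esym/orP[]/eqP vE.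
  by rewrite vE xc in vc.
by rewrite vE mem_next xc in vc.
Qed.

(** E and O consist of the vertices off the cycle at even and odd depth. Edges leaving such a vertex
    change the depth by exactly one. The map f picks a deeper neighbour, and it is injective because
    the neighbour towards the cycle is unique. *)
Lemma off_cycle_matching : exists (E O : {set 'I_n}) (f : 'I_n -> 'I_n),
  [/\ [disjoint E & O], ~: [set x in c] = E :|: O,
      {in E, forall i j, P i j != 0 -> j \in O},
      {in O, forall i, f i \in E /\ P i (f i) != 0} & {in O &, injective f}].
Proof.
pose E := [set v | (v \notin c) && ~~ odd (depth v)].
pose O := [set v | (v \notin c) && odd (depth v)].
have higher i j : e i j -> (depth i < depth j)%N -> depth j = (depth i).+1.
  move=> eij dij; have jc : j \notin c by rewrite -depth_eq0 -lt0n (leq_ltn_trans _ dij).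
  have [q jq dq] := depth_parent jc; rewrite (@lower_neighbor_unique j i q) //.
  - by rewrite adj_sym.
  - exact: ltnW.
  - by rewrite dq.
have lower i j : i \notin c -> e i j -> (depth j <= depth i)%N -> depth i = (depth j).+1.
  move=> ic eij dij; have [q iq dq] := depth_parent ic.
  by rewrite (@lower_neighbor_unique i j q) // dq.
have child i : exists j, i \in O -> [/\ e i j, depth j = (depth i).+1 & j \in E].
  have [iO|iO] := boolP (i \in O); last by exists i.
  move: iO; rewrite inE => /andP[ic oi].
  have [q iq dq] := depth_parent ic.
  (* A vertex at odd depth is not a leaf, so it has a neighbour other than its parent q, and that
     neighbour must be deeper. *)
  have : #|[set w | e i w]| != 1%N by apply: contraTneq oi => /eqP; apply: c_leaf.
  rewrite (cardsD1 q) inE iq eqSS cards_eq0 => /set0Pn[j].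
  rewrite !inE => /andP[jq eij].
  have dij : (depth i < depth j)%N.
    rewrite ltnNge; apply: contra_neqN jq => dj.
    by apply: lower_neighbor_unique ic eij iq dj _; rewrite dq.
  exists j => _; rewrite (higher i j) //=; split=> //.
  by rewrite inE -depth_eq0 (higher i j) //= oi.
have [f fP] := boolp.choice child.
exists E, O, f; split.
- by rewrite disjoints_subset; apply/subsetP => i; rewrite !inE => /andP[-> ->].
- by apply/setP => i; rewrite !inE -andb_orr orNb andbT.
- move=> i; rewrite !inE => /andP[ic ei] j /adj_neq0 eij.
  have [dj|dj] := leqP (depth j) (depth i).
    have := lower i j ic eij dj => di; move: ei; rewrite di /= negbK => oj.
    by rewrite inE -depth_eq0 oj andbT; case: (depth j) oj.
  have := higher i j eij dj => dji.
  by rewrite inE -depth_eq0 dji.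
- by move=> i /fP[/andP[_ Pif] _ fE].
move=> i j /fP[eif di _] /fP[ejf dj _] fij; rewrite -fij in ejf dj.
have fic : f i \notin c by rewrite -depth_eq0 di.
by apply: (lower_neighbor_unique fic); rewrite 1?adj_sym // ?di // -ltnS -dj di.
Qed.

End Graph.

(** * Edge signs and maximal signed paths of the cycle *)

Section CycleSigns.
Variables (n : nat) (P : 'M[int]_n) (c : seq 'I_n).
Hypothesis P_sign : sign_pattern P.
Hypothesis P_sym : comb_symmetric P.
Hypothesis c_cyc : graph_cycle P c.

Local Notation nx := (next c).
Local Notation k := (size c).
Local Notation edge := (fun x : 'I_n => [set x; nx x]).

Definition edge_sign x : int := P x (nx x) * P (nx x) x.

Lemma cycle_uniq : uniq c. Proof. by have [/andP[]] := c_cyc. Qed.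

Lemma cycle_next_inj : injective nx.
Proof. exact: can_inj (prev_next cycle_uniq). Qed.

Lemma orbit_next x : x \in c -> fingraph.orbit nx x =i c /\ fingraph.orbit nx x = traject nx x k.
Proof.
move=> xc; split.
  by move=> z; rewrite (fingraph.orbitE (cycle_next cycle_uniq) cycle_uniq xc) mem_rot.
by rewrite /fingraph.orbit (order_cycle (cycle_next cycle_uniq) cycle_uniq xc).
Qed.

Lemma traject_next_uniq x : x \in c -> uniq (traject nx x k).
Proof. by move=> xc; rewrite -(orbit_next xc).2 orbit_uniq. Qed.

Lemma mem_traject_next x : x \in c -> traject nx x k =i c.
Proof. by move=> xc z; rewrite -(orbit_next xc).2 (orbit_next xc).1. Qed.

Lemma iter_next_cycle x j : (iter j nx x \in c) = (x \in c).
Proof. by elim: j => //= j <-; rewrite mem_next. Qed.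

Lemma next_neq x : x \in c -> nx x != x /\ nx (nx x) != x.
Proof.
move=> xc; have := traject_next_uniq xc; have [_] := c_cyc.
case: (k) => [|[|[|m]]] //= _; rewrite !inE !negb_or => /andP[/and3P[h1 h2 _] _].
by rewrite ![_ == x]eq_sym.
Qed.

(** Two vertices with the same edge could differ only by traversing it in opposite directions; then
    [next] applied twice would fix a vertex, which length at least three excludes. *)
Lemma cycle_edge_inj : {in c &, injective edge}.
Proof.
move=> x y xc yc exy; have [h1 h2] := next_neq yc.
have : x \in edge y by rewrite -exy !inE eqxx.
have : nx x \in edge y by rewrite -exy !inE eqxx orbT.
rewrite !inE => /orP[]/eqP nxE /orP[]/eqP xE //.
  by move: h2; rewrite -xE nxE eqxx.
exact: cycle_next_inj.
Qed.

Lemma cycle_adj x : x \in c -> adj P x (nx x).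
Proof. by move=> xc; have [/andP[cc _] _] := c_cyc; apply: next_cycle. Qed.

Lemma pattern_unit i j : P i j != 0 -> P i j = 1 \/ P i j = -1.
Proof.
by have := P_sign i j; rewrite !inE => /or3P[]/eqP->; [left|right|rewrite eqxx].
Qed.

Lemma edge_sign_unit x : x \in c -> edge_sign x = 1 \/ edge_sign x = -1.
Proof.
move=> /cycle_adj/andP[_ p1]; have p2 : P (nx x) x != 0 by apply/P_sym.
rewrite /edge_sign; case: (pattern_unit p1) => ->; case: (pattern_unit p2) => ->.
- by left.
- by right.
- by right.
- by left.
Qed.

Lemma edge_sign_lt0 x : x \in c -> (edge_sign x < 0) = ~~ (0 < edge_sign x).
Proof. by move=> /edge_sign_unit[]->. Qed.

Lemma set2_eqP (i j x y : 'I_n) : [set i; j] = [set x; y] -> x != y ->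
  (i = x /\ j = y) \/ (i = y /\ j = x).
Proof.
move=> E xy.
have /set2P[iE|iE] : i \in [set x; y] by rewrite -E set21.
  have : y \in [set i; j] by rewrite E set22.
  rewrite iE => /set2P[yx|->]; last by left.
  by rewrite yx eqxx in xy.
have : x \in [set i; j] by rewrite E set21.
rewrite iE => /set2P[yx|->]; last by right.
by rewrite yx eqxx in xy.
Qed.

Lemma edge_pos x : x \in c -> (edge x \in pos_edges P) = (0 < edge_sign x).
Proof.
move=> xc; apply/imsetP/idP => [[[i j]] /=|x0].
  rewrite inE /= => /andP[_ Pij] /esym/set2_eqP[|[iE jE]|[iE jE]].
  - by rewrite eq_sym; have [] := next_neq xc.
  - by rewrite iE jE in Pij.
  - by rewrite iE jE mulrC in Pij.
by exists (x, nx x) => //; rewrite inE /= cycle_adj.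
Qed.

Lemma edge_neg x : x \in c -> (edge x \in neg_edges P) = (edge_sign x < 0).
Proof.
move=> xc; apply/imsetP/idP => [[[i j]] /=|x0].
  rewrite inE /= => /andP[_ Pij] /esym/set2_eqP[|[iE jE]|[iE jE]].
  - by rewrite eq_sym; have [] := next_neq xc.
  - by rewrite iE jE in Pij.
  - by rewrite iE jE mulrC in Pij.
by exists (x, nx x) => //; rewrite inE /= cycle_adj.
Qed.

Lemma cycle_pos_edgeP E : E \in cycle_edges c :&: pos_edges P ->
  exists x, [/\ x \in c, 0 < edge_sign x & E = edge x].
Proof.
by rewrite inE => /andP[/imsetP[x xc ->]]; rewrite edge_pos //; exists x.
Qed.

Definition run x r : {set {set 'I_n}} := [set edge z | z in traject nx x r].

Lemma cycle_runE x r : cycle_run c x r = run x r.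
Proof.
apply/setP => E; apply/imsetP/imsetP => [[j _ ->]|[z /trajectP[j jr ->] ->]].
  by exists (iter j nx x) => //; apply/trajectP; exists j.
by exists (Ordinal jr).
Qed.

(* If the positive edges are r consecutive ones, the only possible maximal signed
   paths are this run and the complementary one. *)
Lemma odd_maximal_runs x r : x \in c -> (r < k)%N ->
  {in c, forall z, (0 < edge_sign z) = (z \in traject nx x r)} ->
  (1 < #|[set S | maximal_signed_path P c S & odd #|S| ]|)%N -> odd r.
Proof.
move=> xc rk posE; case/card_gt1P => S1 [S2 []].
rewrite !inE => /andP[max1 odd1] /andP[max2 odd2] S12.
pose y := iter r nx x.
have yc : y \in c by rewrite iter_next_cycle.
have trE : traject nx x k = traject nx x r ++ traject nx y (k - r).
  by rewrite -trajectD subnKC // ltnW.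
have memE z : (z \in c) = (z \in traject nx x r) || (z \in traject nx y (k - r)).
  by rewrite -(mem_traject_next xc) trE mem_cat.
have tr_uniq : uniq (traject nx x r ++ traject nx y (k - r)).
  by rewrite -trE traject_next_uniq.
have sub_c z : z \in traject nx x r -> z \in c by rewrite memE => ->.
have sub_c' z : z \in traject nx y (k - r) -> z \in c by rewrite memE orbC => ->.
have posR : run x r \subset pos_edges P.
  by apply/subsetP => _ /imsetP[z zr ->]; rewrite edge_pos ?posE // sub_c.
have negR : run y (k - r) \subset neg_edges P.
  apply/subsetP => _ /imsetP[z zr ->]; rewrite edge_neg ?edge_sign_lt0 ?posE ?sub_c' //.
  by move: tr_uniq; rewrite cat_uniq => /and3P[_ /hasPn/(_ z zr)].
have run_signed z l : z \in c -> (0 < l <= k)%N ->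
    (run z l \subset pos_edges P) || (run z l \subset neg_edges P) -> signed_run P c (run z l).
  move=> zc /andP[l0 lk] sg; rewrite /signed_run sg andbT; apply/existsP; exists z; rewrite zc /=.
  by apply/existsP; exists (Ordinal (lk : (l < k.+1)%N)); rewrite l0 cycle_runE eqxx.
(* A signed path lies within the set of all positive edges or that of all negative edges of the
   cycle. Here both sets are runs, so maximality forces equality. *)
have maxE S : maximal_signed_path P c S -> S = run x r \/ S = run y (k - r).
  move=> /maxsetP[/andP[/existsP[z /andP[zc /existsP[l /andP[l0 /eqP SE]]]] sgn] Smax].
  have Sc E : E \in S -> exists2 u, u \in c & E = edge u.
    rewrite SE cycle_runE => /imsetP[u /trajectP[j _ ->] ->].
    by exists (iter j nx z); rewrite // iter_next_cycle.
  have zS : edge z \in S.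
    by rewrite SE; apply/imsetP; exists (Ordinal l0).
  case/orP: sgn => sgn; [left|right]; apply/esym/Smax.
  (* A signed run must have positive length; r is nonzero since S contains a positive edge. *)
  - apply: run_signed; rewrite ?posR // (ltnW rk) andbT lt0n.
    apply: contraTneq zS => r0; apply/negP => /(subsetP sgn).
    by rewrite edge_pos // posE // r0.
  - apply/subsetP => E ES; have [u uc EE] := Sc E ES.
    have := subsetP sgn E ES; rewrite EE edge_pos // posE // => ur.
    exact: imset_f.
  - by apply: run_signed; rewrite ?negR ?orbT // subn_gt0 rk leq_subr.
  - apply/subsetP => E ES; have [u uc EE] := Sc E ES.
    have := subsetP sgn E ES; rewrite EE edge_neg // edge_sign_lt0 // posE // => ur.
    by apply: imset_f; move: uc; rewrite memE (negPf ur).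
have card_run : #|run x r| = r.
  rewrite card_in_imset => [|u v ux vx]; last by apply: cycle_edge_inj; apply: sub_c.
  move: tr_uniq; rewrite cat_uniq => /andP[/card_uniqP-> _].
  by rewrite size_traject.
(* Two distinct maximal paths cannot both be the complementary run, so one of them is the positive
   run, whose length r is then odd. *)
have [S1E|S1E] := maxE _ max1; first by rewrite -card_run -S1E.
have [S2E|S2E] := maxE _ max2; first by rewrite -card_run -S2E.
by rewrite S1E S2E eqxx in S12.
Qed.

(** Only (ii) with k even and no two disjoint positive edges needs work. Then any two positive edges
    meet, and as k is at least 4 there are at most two of them, consecutive. Zero or two would make
    the positive run even, contrary to [odd_maximal_runs], so exactly one is left. *)
Lemma cycle_trichotomy :
  (exists E1 E2 : {set 'I_n},
      [/\ E1 \in cycle_edges c :&: pos_edges P,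
          E2 \in cycle_edges c :&: pos_edges P
        & [disjoint E1 & E2] ])
  \/ (1 < #|[set S | maximal_signed_path P c S & odd #|S| ]|)%N
  \/ (odd k /\ exists E : {set 'I_n}, E \in cycle_edges c :&: pos_edges P) ->
  [\/ exists x y, [/\ x \in c, y \in c, 0 < edge_sign x, 0 < edge_sign y
                    & [disjoint edge x & edge y]],
      odd k /\ (exists2 x, x \in c & 0 < edge_sign x)
    | ~~ odd k /\ (exists x, [/\ x \in c, 0 < edge_sign x
        & {in c, forall y, y != x -> edge_sign y = -1}])].
Proof.
case=> [[E1 [E2 [/cycle_pos_edgeP[x [xc x0 ->]] /cycle_pos_edgeP[y [yc y0 ->]] dxy]]]|].
  by constructor 1; exists x, y.
case=> [odd_runs|[ok [E /cycle_pos_edgeP[x [xc x0 _]]]]]; last first.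
  by constructor 2; split=> //; exists x.
have [disj|ndisj] := boolp.pselect (exists x y, [/\ x \in c, y \in c, 0 < edge_sign x,
    0 < edge_sign y & [disjoint edge x & edge y]]); first by constructor 1.
have k3 : (3 <= k)%N by have [] := c_cyc.
have [x0 x0c] : exists x, x \in c by case: (c) k3 => // x s _; exists x; rewrite mem_head.
have [[x xc xpos]|npos] := boolp.pselect (exists2 x, x \in c & 0 < edge_sign x); last first.
  (* Without positive edges the positive run is empty, that is, r = 0. *)
  have : odd 0; last by [].
  apply: (odd_maximal_runs x0c _ _ odd_runs); first exact: leq_trans k3.
  by move=> z zc; apply/negbTE/negP => zpos; apply: npos; exists z.
have [ok|ek] := boolP (odd k); first by constructor 2; split=> //; exists x.
have meet u v : u \in c -> v \in c -> 0 < edge_sign u -> 0 < edge_sign v ->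
    [\/ v = u, v = nx u | u = nx v].
  move=> uc vc up vp.
  have : ~~ [disjoint edge u & edge v] by apply/negP => d; apply: ndisj; exists u, v.
  rewrite -setI_eq0 => /set0Pn[z]; rewrite !inE.
  case/andP => /orP[]/eqP-> /orP[]/eqP h.
  - by constructor 1.
  - by constructor 3.
  - by constructor 2.
  - by constructor 1; apply: cycle_next_inj.
(* Two consecutive positive edges would be all the positive edges, that is, r = 2. *)
have no_pair u : u \in c -> 0 < edge_sign u -> 0 < edge_sign (nx u) -> False.
  move=> uc up nup; have : odd 2; last by [].
  apply: (odd_maximal_runs uc _ _ odd_runs) => // z zc; rewrite !inE.
  apply/idP/orP => [zp|[]/eqP-> //].
  have [->||uz] := meet u z uc zc up zp; [by left|by right; apply/eqP|].
  have nuc : nx u \in c by rewrite mem_next.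
  have [->||/cycle_next_inj->] := meet (nx u) z nuc zc nup zp; [by right|move=> zE|by left].
  (* A third positive edge meeting both would close a triangle, but k is even and at least 3. *)
  have := traject_next_uniq uc; move: ek k3 (mem_traject_next uc); case: (k) => [|[|[|[|m]]]] //= _ _ _.
  by rewrite -zE -uz !inE eqxx ?orbT /= ?andbF.
constructor 3; split=> //; exists x; split=> // y yc yx.
have [yp|//] := edge_sign_unit yc.
have yp' : 0 < edge_sign y by rewrite yp.
have [yE|yE|yE] := meet x y xc yc xpos yp'.
- by rewrite yE eqxx in yx.
- by case: (no_pair x xc xpos); rewrite -yE.
- by case: (no_pair y yc yp'); rewrite -yE.
Qed.

(** The k - 1 negative edges are odd in number. This product is also that of the constants e of the
    two orientations of the cycle. *)
Lemma cycle_sign_prod x : ~~ odd k -> x \in c -> 0 < edge_sign x ->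
  {in c, forall y, y != x -> edge_sign y = -1} ->
  \prod_(y in c) edge_sign y = -1.
Proof.
move=> ek xc xp xN; rewrite (bigD1 x) //=.
have -> : edge_sign x = 1 by have [//|h] := edge_sign_unit xc; rewrite h in xp.
rewrite mul1r (eq_bigr (fun=> -1)) => [|y /andP[yc yx]]; last exact: xN.
rewrite prodr_const -signr_odd (_ : odd _ = true) //.
have := card_uniqP cycle_uniq; rewrite (cardD1 x (mem c)) [x \in _]xc => kE.
move: ek; rewrite -kE add1n /= negbK => <-; congr odd; apply: eq_card => y.
by rewrite !inE /= andbC.
Qed.

End CycleSigns.

(** * Limits of matrices of the pattern *)

Section Limits.
Variables (R : realType) (n : nat) (P : 'M[int]_n).
Hypothesis P_sign : sign_pattern P.

(** These matrices form the closure of the qualitative class; [fill_pattern] gives a direction from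
    each of them into the class. *)
Definition qual_limit (A0 : 'M[R]_n) : Prop :=
  forall i j, A0 i j = 0 \/ sgz (A0 i j) = P i j.

Definition fill_pattern (A0 : 'M[R]_n) : 'M[R]_n :=
  \matrix_(i, j) (if A0 i j == 0 then (P i j)%:~R else 0).

Lemma fill_pattern_qual A0 t : qual_limit A0 -> 0 < t ->
  qual_class P (A0 + t *: fill_pattern A0).
Proof.
move=> A0P t0 i j; rewrite !mxE; case: ifPn => [/eqP->|Aij].
  rewrite add0r sgzM gtr0_sgz // mul1r.
  by have := P_sign i j; rewrite !inE => /or3P[]/eqP->; rewrite ?sgz1 ?sgzN1 ?sgz0.
by rewrite mulr0 addr0; case: (A0P i j) => // A0ij; rewrite A0ij eqxx in Aij.
Qed.

Lemma consistent_le_limit k' A0 M :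
  (forall A : 'M[R]_n, qual_class P A -> nb_real_eigenvalues A = k') ->
  qual_limit A0 -> at_most_nroots M (char_poly A0) -> (k' <= M)%N.
Proof.
move=> Ak A0P; apply: has_nroots_le; first exact/monic_neq0/char_poly_monic.
apply: (@limit_char_poly_has_nroots _ _ _ (fill_pattern A0)) => t t0.
rewrite -(Ak _ (fill_pattern_qual A0P t0)).
exact: has_nb_real_eigenvalues.
Qed.

(** The signs at the finitely many half-integers persist for small t, so each a in s yields a root
    within 1/2 of a. Distinct nonzero integers give distinct nonzero roots, and the factor ['X^m]
    adds m more. *)
Lemma sign_changes_lower_bound A0 m (s : seq int) :
  qual_limit A0 -> (forall A : 'M[R]_n, qual_class P A -> 'X^m %| char_poly A) ->
  uniq s -> 0 \notin s ->
  {in s, forall a, (char_poly A0).[a%:~R - 2^-1] * (char_poly A0).[a%:~R + 2^-1] < 0} ->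
  exists2 A : 'M[R]_n, qual_class P A & (m + size s <= nb_real_eigenvalues A)%N.
Proof.
move=> A0P mP us s0 sgn.
pose ys := [seq a%:~R - 2^-1 : R | a <- s] ++ [seq a%:~R + 2^-1 | a <- s].
have [|t t0 tP] := @pencil_same_sign R n A0 (fill_pattern A0) ys.
  move=> y; rewrite mem_cat => /orP[]/mapP[a sa ->]; have := sgn a sa;
    by apply: contraTneq => ->; rewrite ?mul0r ?mulr0 ltxx.
pose A := A0 + t *: fill_pattern A0.
have AP : qual_class P A by apply: fill_pattern_qual.
exists A => //; pose p := char_poly A.
have p0 : p != 0 by apply/monic_neq0/char_poly_monic.
have /boolp.choice[z zP] : forall a, exists z : R, a \in s ->
    [/\ a%:~R - 2^-1 < z, z < a%:~R + 2^-1 & root p z].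
  move=> a; have [sa|_] := boolP (a \in s); last by exists 0.
  have h1 : 0 < (char_poly A0).[a%:~R - 2^-1] * p.[a%:~R - 2^-1].
    by apply: tP; rewrite mem_cat; apply/orP; left; apply/mapP; exists a.
  have h2 : 0 < (char_poly A0).[a%:~R + 2^-1] * p.[a%:~R + 2^-1].
    by apply: tP; rewrite mem_cat; apply/orP; right; apply/mapP; exists a.
  have h3 : p.[a%:~R - 2^-1] * p.[a%:~R + 2^-1] < 0.
    move: h1 h2 (sgn a sa); set u := _.[_]; set v := _.[_]; set u' := _.[_]; set v' := _.[_].
    move=> h1 h2 h3; have := mulr_gt0 h1 h2.
    by rewrite mulrACA nmulr_rgt0.
  have le : a%:~R - 2^-1 <= a%:~R + 2^-1 :> R by lra.
  have [x xI rx] := poly_ivtoo le h3.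
  by exists x => _; split=> //; rewrite (itvP xI).
have zs0 : 0 \notin [seq z a | a <- s].
  apply/negP => /mapP[a sa /esym za]; have [z1 z2 _] := zP a sa.
  have a0 : a != 0 by apply: contraNneq s0 => <-.
  have : (1 : R) <= `|a%:~R| by rewrite -intr_norm ler1z -gtz0_ge1 normr_gt0.
  by rewrite za in z1 z2; rewrite ler_normr => /orP[]; lra.
have zs_uniq : uniq [seq z a | a <- s].
  rewrite map_inj_in_uniq // => a b sa sb zab.
  have [a1 a2 _] := zP a sa; have [b1 b2 _] := zP b sb; rewrite zab in a1 a2.
  apply/eqP; rewrite -subr_eq0 -[_ == _]negbK -normr_gt0 gtz0_ge1 -(ler1z R).
  rewrite intr_norm rmorphB /= -ltNge ltr_norml.
  by apply/andP; split; lra.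
rewrite -(size_map z); apply: nb_real_eigenvalues_ge.
apply: has_nroots_zero_mul => //; last exact: mP.
by move=> x /mapP[a sa ->]; have [_ _] := zP a sa.
Qed.

End Limits.

(** * Characteristic polynomial of an oriented cycle with disjoint edges *)

Section SparseLimit.
Variables (R : realType) (n : nat) (P : 'M[int]_n).
Hypothesis P_diag : zero_diagonal P.
Variables (C Q : {set 'I_n}) (s : 'S_n) (g : 'I_n -> 'I_n) (w : 'I_n -> R).
Hypothesis w_gt0 : forall x, 0 < w x.
Hypothesis g_inj : {in Q &, injective g}.
Hypothesis gQ : {in Q, forall x, g x \notin Q}.
Hypothesis CQ : {in Q, forall x, x \notin C}.
Hypothesis CgQ : {in Q, forall x, g x \notin C}.
Hypothesis sC : {in C, forall x, s x \in C}.

(** The pairs {x, g x} keep both of their entries, with a common weight, whereas C keeps only the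
    entries in the direction of s. *)
Definition sparse_limit : 'M[R]_n := \matrix_(i, j) ((P i j)%:~R *
  (if (i \in Q) && (j == g i) then w i
   else if (j \in Q) && (i == g j) then w j
   else ((i \in C) && (j == s i))%:R)).

Lemma sparse_limit_qual : sign_pattern P -> qual_limit P sparse_limit.
Proof.
move=> P_sign i j; rewrite mxE; set a := (if _ then _ else _).
have : 0 <= a.
  rewrite /a; case: ifP => _; first exact: ltW.
  by case: ifP => _; [exact: ltW|exact: ler0n].
rewrite le_eqVlt => /orP[/eqP<-|a0]; first by left; rewrite mulr0.
right; rewrite sgzM (gtr0_sgz a0) mulr1.
by have := P_sign i j; rewrite !inE => /or3P[]/eqP->; rewrite ?sgz1 ?sgzN1 ?sgz0.
Qed.

Let M := char_poly_mx sparse_limit.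

Let M_diag x : M x x = 'X.
Proof. by apply: char_poly_mx_diag; rewrite mxE P_diag mul0r. Qed.

Let M_cycle_row x j : x \in C -> j != x ->
  M x j = - ((P x j)%:~R * (j == s x)%:R)%:P.
Proof.
move=> xC jx; rewrite /M char_poly_mx_offdiag; last by rewrite eq_sym.
rewrite mxE xC.
have -> : x \in Q = false by apply: contraTF xC; apply: CQ.
rewrite /=; case: andP => [[jQ /eqP xE]|//]; by have := CgQ jQ; rewrite -xE xC.
Qed.

Let M_head_row x j : x \in Q -> j != x ->
  M x j = - ((P x j)%:~R * (w x *+ (j == g x)))%:P.
Proof.
move=> xQ jx; rewrite /M char_poly_mx_offdiag; last by rewrite eq_sym.
rewrite mxE xQ /=.
case: eqP => // _; rewrite mulr0n.
case: andP => [[jQ /eqP xE]|_]; first by have := gQ jQ; rewrite -xE xQ.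
by rewrite (negPf (CQ xQ)).
Qed.

Let M_partner_row x j : x \in Q -> j != g x ->
  M (g x) j = - ((P (g x) j)%:~R * (w x *+ (j == x)))%:P.
Proof.
move=> xQ jx; rewrite /M char_poly_mx_offdiag; last by rewrite eq_sym.
rewrite mxE (negPf (gQ xQ)) /=.
rewrite (negPf (CgQ xQ)) /=; have [jE|jx'] := eqVneq j x.
  by rewrite jE xQ eqxx.
case: andP => [[jQ /eqP /g_inj gE]|//].
by rewrite gE ?eqxx in jx'.
Qed.

Let M_rest_row x j : x \notin C -> x \notin Q -> x \notin g @: Q -> j != x -> M x j = 0.
Proof.
move=> xC xQ xgQ jx; rewrite /M char_poly_mx_offdiag; last by rewrite eq_sym.
rewrite mxE.
rewrite (negPf xC) (negPf xQ) /=; case: andP => [[jQ /eqP xE]|_].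
  by rewrite xE imset_f in xgQ.
by rewrite mulr0 oppr0.
Qed.

(** The rows of C, of each pair and of every remaining index vanish outside their own block, so the
    determinant is a product of principal minors; a remaining index contributes a factor X. *)
Lemma char_poly_sparse : char_poly sparse_limit =
  \det (row_restrict C M) *
  (\prod_(x in Q) ('X^2 - ((P x (g x) * P (g x) x)%:~R * w x ^+ 2)%:P) *
   'X^#|~: (C :|: (Q :|: g @: Q))|).
Proof.
have gx_x x : x \in Q -> g x != x.
  by move=> xQ; apply: contraNneq (gQ xQ) => ->.
set U := ~: _; rewrite /char_poly -/M -[X in \det X = _](row_restrictT M).
have -> : [set: 'I_n] = C :|: ((Q :|: g @: Q) :|: U) by rewrite setUA setUCr.
rewrite det_row_restrictU; first congr (_ * _).
- rewrite det_row_restrictU.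
  + congr (_ * _).
      rewrite det_row_restrict_pairs //.
        apply: eq_bigr => x xQ; rewrite !M_diag M_head_row ?gx_x // M_partner_row //.
          by rewrite !eqxx !mulr1n mulrNN -polyCM intrM expr2 mulrACA.
        by rewrite eq_sym gx_x.
      move=> x xQ j jx jg; rewrite M_head_row // M_partner_row //.
      by rewrite (negPf jx) (negPf jg) !mulr0 oppr0.
    rewrite det_row_restrict_diag.
      by rewrite (eq_bigr (fun=> 'X)) ?prodr_const.
    move=> i; rewrite !inE !negb_or => /and3P[iC iQ ig] j ji.
    exact: M_rest_row.
  + by rewrite disjoints_subset setCK subsetUr.
  + move=> i j iQ; rewrite !inE !negb_or => /and3P[jC jQ jg].
    case/setUP: iQ => [iQ|/imsetP[x xQ ->]].
      rewrite M_head_row //; last by apply: contraNneq jQ => ->.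
      by case: eqP jg => [->|_ _]; rewrite ?imset_f // mulr0n mulr0 oppr0.
    rewrite M_partner_row //; last by apply: contraNneq jg => ->; rewrite imset_f.
    by case: eqP jQ => [->|_ _]; rewrite ?xQ // mulr0n mulr0 oppr0.
- rewrite disjoint_sym disjoints_subset; apply/subsetP => i.
  rewrite inE => /orP[/setUP[/CQ|/imsetP[x /CgQ xC ->]]|]; rewrite ?inE //.
  by rewrite !negb_or => /andP[].
- move=> i j iC jN; have jC : j \notin C.
    move: jN; rewrite inE => /orP[/setUP[/CQ//|/imsetP[x /CgQ xC ->//]]|].
    by rewrite !inE !negb_or => /andP[].
  rewrite M_cycle_row //; last by apply: contraNneq jC => ->.
  by case: eqP jC => [->|_ _]; rewrite ?sC // mulr0 oppr0.
Qed.

(** Since s is a single cycle on C, only the identity and s contribute to the Leibniz formula. The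
    integer constant is the e in X^k + e. *)
Lemma det_cycle_block : C != set0 -> {in C, forall i, s i != i} ->
  (forall i, i \notin C -> s i = i) ->
  (forall Z : {set 'I_n}, Z \subset C -> Z != set0 -> {in Z, forall i, s i \in Z} -> Z = C) ->
  \det (row_restrict C M) = 'X^#|C| + ((-1) ^+ s * \prod_(i in C) - P i (s i))%:~R%:P.
Proof.
move=> C0 sN sid sZ; rewrite (@det_row_restrict_cycle _ _ _ _ s) //; last first.
  by move=> i iC j ji js; rewrite M_cycle_row // (negPf js) mulr0 oppr0.
congr (_ + _); first by rewrite (eq_bigr (fun=> 'X)) ?prodr_const.
rewrite intrM polyCM; congr (_ * _).
  by case: (odd_perm s); rewrite ?expr1 ?mulrN1z ?polyCN // mulr1z polyC1.
rewrite rmorph_prod rmorph_prod /=; apply: eq_bigr => i iC.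
by rewrite M_cycle_row ?sN // eqxx mulr1 rmorphN /= polyCN.
Qed.

End SparseLimit.

(** * Real roots of X^k + 1 and X^k - 1 *)

Section BinomialRoots.
Variable R : realType.

(** A repeated root would be a root of the derivative, so the list of real roots has no repetition
    and embeds into r. *)
Lemma at_most_nroots_simple (p : {poly R}) (r : seq R) : p != 0 ->
  (forall x, root p x -> x \in r /\ ~~ root p^`() x) -> at_most_nroots (size r) p.
Proof.
move=> p0 pr; have [s [q [pE qN]]] := real_root_factorization p0.
have rs x : x \in s -> root p x by move=> xs; rewrite pE rootM root_prod_XsubC xs.
exists s, q; split=> //; apply: uniq_leq_size => [|x /rs/pr[]//].
apply: count_mem_uniq => x; have [xs|xs] := boolP (x \in s); last exact/count_memPn.
apply/eqP; rewrite eqn_leq -[X in _ && X]has_count has_pred1 xs andbT leqNgt.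
rewrite -(mup_rootless x s qN) -pE mup_geq //; apply/negP => /dvdpP[u uE].
have [_ /negP[]] := pr x (rs x xs).
rewrite -dvdp_XsubCl uE expr2 !derivM derivXsubC mul1r mulr1.
by rewrite dvdp_add // dvdp_mull // ?dvdp_mull // dvdp_add.
Qed.

Lemma Xn_addC_neq0 (k : nat) (b : R) : (0 < k)%N -> 'X^k + b%:P != 0.
Proof. by move=> k0; rewrite -size_poly_gt0 size_XnaddC. Qed.

Lemma Xn_addC_simple (k : nat) (b x : R) : (0 < k)%N -> b != 0 ->
  root ('X^k + b%:P) x -> ~~ root ('X^k + b%:P)^`() x.
Proof.
move=> k0 b0; rewrite derivD derivXn derivC addr0 !rootE !hornerE hornerMn hornerXn => xk.
have x0 : x != 0.
  by apply: contraNneq b0 => x0; move: xk; rewrite x0 expr0n gtn_eqF // add0r.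
by rewrite mulrn_eq0 negb_or -lt0n k0 expf_neq0.
Qed.

(** A real root has absolute value 1, hence is 1 or -1, and it is simple. For odd k only -b is a
    root; for even k there is none if b = 1, and 1 and -1 are the candidates if b = -1. *)
Lemma at_most_nroots_Xn_sign (k : nat) (b : int) : (0 < k)%N -> b = 1 \/ b = -1 ->
  at_most_nroots (if odd k then 1 else if b == 1%R then 0 else 2)%N ('X^k + b%:~R%:P : {poly R}).
Proof.
move=> k0 b1; have b0 : b%:~R != 0 :> R by rewrite intr_eq0; case: b1 => ->.
have p0 := Xn_addC_neq0 b%:~R k0.
have norm1 (x : R) : root ('X^k + b%:~R%:P) x -> `|x| = 1.
  rewrite rootE !hornerE addr_eq0 => /eqP xk.
  have : `|x| ^+ k = 1 by rewrite -normrX xk normrN; case: b1 => ->; rewrite ?normrN1 ?normr1.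
  by move/eqP; rewrite pexpr_eq1 // => /eqP.
have pm1 (x : R) : root ('X^k + b%:~R%:P) x -> x = 1 \/ x = -1.
  move=> rx; have /eqP := norm1 x rx.
  by rewrite eqr_norml => /andP[/orP[]/eqP-> _]; [left|right].
case: ifP => ok.
  have -> : 1%N = size [:: - b%:~R : R] by [].
  apply: at_most_nroots_simple => // x rx; split; last exact: Xn_addC_simple rx.
  have := rx; rewrite rootE !hornerE inE addr_eq0.
  by case: (pm1 x rx) => ->; rewrite ?expr1n // -signr_odd ok expr1.
case: ifP => [/eqP bE|_].
  apply: at_most_nroots0 => x; apply/negP => rx.
  have xk : x ^+ k = 1.
    by case: (pm1 x rx) => ->; rewrite ?expr1n // -signr_odd ok.
  by move: rx; rewrite rootE !hornerE xk bE mulr1z -[1 + 1]/(2%:R) pnatr_eq0.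
have -> : 2%N = size [:: 1; -1 : R] by [].
apply: at_most_nroots_simple => // x rx; split; last exact: Xn_addC_simple rx.
by rewrite !inE; case: (pm1 x rx) => ->; rewrite eqxx ?orbT.
Qed.

Lemma at_most_nroots_X2_sign (b : int) : b = 1 \/ b = -1 ->
  at_most_nroots (if (0 < b)%R then 2 else 0)%N ('X^2 - b%:~R%:P : {poly R}).
Proof.
move=> b1; rewrite -polyCN -rmorphN.
have := @at_most_nroots_Xn_sign 2 (- b) isT; rewrite /=.
case: b1 => ->; apply; by [right|left; rewrite opprK].
Qed.

End BinomialRoots.

(** * Sign changes of the quadratic factors *)

Section PairSigns.
Variable R : realType.

(* For natural a, b > 0 the polynomial X^2 - b^2 changes sign between
   a - 1/2 and a + 1/2 exactly when a = b. *)
Lemma pair_factor_same (a : R) : 1 <= a ->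
  ((a - 2^-1) ^+ 2 - a ^+ 2) * ((a + 2^-1) ^+ 2 - a ^+ 2) < 0.
Proof.
move=> a1; have -> : ((a - 2^-1) ^+ 2 - a ^+ 2) * ((a + 2^-1) ^+ 2 - a ^+ 2) =
  16^-1 - a * a by field.
by have := ler_pM ler01 ler01 a1 a1; lra.
Qed.

Lemma pair_factor_diff (a b : R) : 0 < b -> 1 <= a -> (a + 1 <= b) || (b + 1 <= a) ->
  0 < ((a - 2^-1) ^+ 2 - b ^+ 2) * ((a + 2^-1) ^+ 2 - b ^+ 2).
Proof.
move=> b0 a1 ab; rewrite !subr_sqr.
case/orP: ab => ab.
  rewrite -mulrNN mulr_gt0 // -mulNr mulr_gt0 //; lra.
by rewrite !mulr_gt0 //; lra.
Qed.

Lemma pair_factor_neg (x y b : R) : 0 < b -> 0 < (x ^+ 2 + b ^+ 2) * (y ^+ 2 + b ^+ 2).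
Proof. by move=> b0; rewrite mulr_gt0 // ltr_wpDl ?sqr_ge0 // exprn_gt0. Qed.
End PairSigns.

(** * Two bounds on the number of real eigenvalues *)

Section Bounds.
Variables (R : realType) (n : nat) (P : 'M[int]_n).
Hypothesis P_sign : sign_pattern P.
Hypothesis P_diag : zero_diagonal P.
Hypothesis P_sym : comb_symmetric P.

Let pair_sign_unit x y : P x y != 0 ->
  P x y * P y x = 1 \/ P x y * P y x = -1.
Proof.
move=> p1; have p2 : P y x != 0 by apply/P_sym.
case: (pattern_unit P_sign p1) => ->; case: (pattern_unit P_sign p2) => ->;
  by rewrite ?mulN1r ?mul1r ?opprK; by [left|right].
Qed.

(** With distinct positive integer weights, each positive pair contributes two simple roots, plus
    and minus its weight. Near such a root only its own quadratic factor changes sign. *)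
Lemma consistent_lower_bound k' m (Q : {set 'I_n}) (g : 'I_n -> 'I_n) :
  (forall A : 'M[R]_n, qual_class P A -> nb_real_eigenvalues A = k') ->
  (forall A : 'M[R]_n, qual_class P A -> 'X^m %| char_poly A) ->
  {in Q &, injective g} -> {in Q, forall x, g x \notin Q} ->
  {in Q, forall x, P x (g x) != 0} ->
  (m + 2 * #|[set x in Q | (0 < P x (g x) * P (g x) x)%R]| <= k')%N.
Proof.
move=> Ak mP gi gQ Pg; set Qp := [set x in Q | _].
(* Ordinals start at 0; the successor makes all the weights positive. *)
pose w (x : 'I_n) : R := x.+1%:R.
have w0 x : 0 < w x by rewrite ltr0n.
pose A0 := sparse_limit P set0 Q 1%g g w.
pose s := [seq (x.+1 : int) | x : 'I_n <- enum Qp] ++ [seq - (x.+1 : int) | x : 'I_n <- enum Qp].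
have s_size : size s = (2 * #|Qp|)%N by rewrite size_cat !size_map -!cardE mul2n addnn.
have [|||||A AP] := @sign_changes_lower_bound R n P P_sign A0 m s.
- exact: sparse_limit_qual.
- exact: mP.
- rewrite cat_uniq !map_inj_uniq ?enum_uniq ?andbT //=; last 2 first.
    by move=> x y xy; apply: ord_inj; lia.
    by move=> x y xy; apply: ord_inj; lia.
  by apply/hasPn => a /mapP[x _ ->]; apply/negP => /mapP[y _ /eqP]; lia.
- by rewrite mem_cat negb_or; apply/andP; split; apply/negP => /mapP[y _ /eqP]; lia.
- move=> a sa.
  have [v vQp av] : exists2 v : 'I_n, v \in Qp & a%:~R = w v \/ a%:~R = - w v.
    move: sa; rewrite mem_cat => /orP[]/mapP[v]; rewrite mem_enum => vQ ->; exists v => //.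
      by left; rewrite /w pmulrn.
    by right; rewrite /w intrN pmulrn.
  have charE y : (char_poly A0).[y] =
      \prod_(x in Q) (y ^+ 2 - (P x (g x) * P (g x) x)%:~R * w x ^+ 2) *
      y ^+ #|~: (set0 :|: (Q :|: g @: Q))|.
    rewrite /A0 char_poly_sparse //; try by move=> x; rewrite inE.
    rewrite row_restrict0 det1 mul1r hornerM hornerXn horner_prod; congr (_ * _).
    by apply: eq_bigr => x _; rewrite !hornerE.
  have v1 : 1 <= w v by rewrite ler1n.
  (* Both endpoints lie on the same side of 0, so the power of X does not affect the sign of the
     product. *)
  have y12 : 0 < (a%:~R - 2^-1) * (a%:~R + 2^-1) :> R.
    by rewrite -subr_sqr; case: av => ->; rewrite ?sqrrN subr_gt0 ltr_pXn2r ?nnegrE //; lra.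
  rewrite !charE mulrACA -exprMn -big_split /= pmulr_llt0 ?exprn_gt0 //.
  (* The factors depend only on squares: replacing a by -a merely swaps the two endpoints. *)
  rewrite (eq_bigr (fun x => ((w v - 2^-1) ^+ 2 - (P x (g x) * P (g x) x)%:~R * w x ^+ 2) *
      ((w v + 2^-1) ^+ 2 - (P x (g x) * P (g x) x)%:~R * w x ^+ 2))); last first.
    move=> x _; case: av => -> //.
    by move: (w v) (_ * w x ^+ 2) => u z; ring.
  move: vQp; rewrite inE => /andP[vQ vpos]; rewrite (bigD1 v) //= pmulr_llt0.
    case: (pair_sign_unit (Pg v vQ)) => vE; last by rewrite vE in vpos.
    by rewrite vE mul1r; apply: pair_factor_same.
  apply: prodr_gt0 => x /andP[xQ xv].
  case: (pair_sign_unit (Pg x xQ)) => ->; rewrite ?mul1r ?mulN1r.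
    apply: pair_factor_diff => //; rewrite /w -(natrD _ v.+1 1) -(natrD _ x.+1 1) !ler_nat.
    by move: xv; rewrite -val_eqE /=; lia.
  by rewrite !opprK; apply: pair_factor_neg.
by rewrite s_size Ak.
Qed.

(** In the limit that keeps the matching with weights 1 and the direction s of C, the three summands
    bound the real roots of X^k + e, of the quadratic factors, and of the remaining power of X. *)
Lemma consistent_upper_bound k' (C E O : {set 'I_n}) (f : 'I_n -> 'I_n) (s : 'S_n) :
  (forall A : 'M[R]_n, qual_class P A -> nb_real_eigenvalues A = k') ->
  [disjoint E & O] -> ~: C = E :|: O ->
  {in O, forall i, f i \in E /\ P i (f i) != 0} -> {in O &, injective f} ->
  C != set0 -> {in C, forall i, s i != i} -> {in C, forall i, s i \in C} ->
  (forall i, i \notin C -> s i = i) ->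
  (forall Z : {set 'I_n}, Z \subset C -> Z != set0 -> {in Z, forall i, s i \in Z} -> Z = C) ->
  {in C, forall i, P i (s i) != 0} ->
  (k' <= (if odd #|C| then 1 else
          if ((-1) ^+ s * \prod_(i in C) - P i (s i) == 1)%R then 0 else 2) +
         (2 * #|[set x in O | (0 < P x (f x) * P (f x) x)%R]| + (#|E| - #|O|)))%N.
Proof.
move=> Ak dEO CE fO fi C0 sN sC sid sZ sP.
have NC x : x \in E :|: O -> x \notin C by rewrite -CE inE.
have CO : {in O, forall x, x \notin C} by move=> x xO; apply: NC; rewrite inE xO orbT.
have CfO : {in O, forall x, f x \notin C}.
  by move=> x /fO[xE _]; apply: NC; rewrite inE xE.
have fNO : {in O, forall x, f x \notin O}.
  by move=> x /fO[xE _]; rewrite (disjointFr dEO xE).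
pose A0 : 'M[R]_n := sparse_limit P C O s f (fun=> 1).
apply: (consistent_le_limit P_sign Ak (_ : qual_limit P A0)).
  by apply: sparse_limit_qual => // x; exact: ltr01.
rewrite /A0 char_poly_sparse //.
have b_unit : (-1) ^+ s * \prod_(i in C) - P i (s i) = 1 \/
              (-1) ^+ s * \prod_(i in C) - P i (s i) = -1 :> int.
  have : \prod_(i in C) - P i (s i) = 1 \/ \prod_(i in C) - P i (s i) = -1.
    apply: (big_ind (fun x : int => x = 1 \/ x = -1)) => [|x y [->|->] [->|->]|i iC];
      rewrite ?mul1r ?mulN1r ?opprK; try by [left|right].
    by case: (pattern_unit P_sign (sP i iC)) => ->; rewrite ?opprK; [right|left].
  case: (odd_perm s) => [] [->|->]; rewrite ?expr0 ?expr1 ?mul1r ?mulN1r ?opprK; by [left|right].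
rewrite det_cycle_block //.
apply: at_most_nrootsM.
  by apply: at_most_nroots_Xn_sign => //; rewrite card_gt0.
apply: at_most_nrootsM.
  rewrite (_ : (2 * _)%N = \sum_(x in O) if (0 < P x (f x) * P (f x) x)%R then 2 else 0)%N.
    apply: at_most_nroots_prod => x /fO[_ Px]; rewrite expr1n mulr1.
    exact/at_most_nroots_X2_sign/pair_sign_unit.
  rewrite -big_mkcondr /= sum_nat_const mulnC; congr (_ * _)%N.
  by apply: eq_card => x; rewrite inE.
(* The remaining indices are the vertices of E missed by f; injectivity of f on O bounds their
   number by |E| - |O|. *)
apply: at_most_nroots_size; first by rewrite expf_neq0 // polyX_eq0.
rewrite size_polyXn ltnS.
rewrite -(card_in_imset fi) setCU CE setIUl.
rewrite (_ : O :&: _ = set0) ?setU0; last by apply/setP => x; rewrite !inE; case: (x \in O).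
rewrite setCU setIA.
have -> : E :&: ~: O = E.
  by apply/setIidPl; rewrite -disjoints_subset.
rewrite -setDE cardsD leq_sub2l // subset_leq_card // subsetI subxx andbT.
by apply/subsetP => _ /imsetP[x /fO[xE _] ->].
Qed.

End Bounds.

(** * The cycle as a permutation of the vertices *)

Section CyclePermutation.
Variables (n : nat) (P : 'M[int]_n) (c : seq 'I_n).
Hypothesis c_cyc : graph_cycle P c.

Definition next_perm : 'S_n := perm (cycle_next_inj c_cyc).

Lemma next_perm_out x : x \notin c -> next_perm x = x.
Proof. by move=> xc; rewrite permE next_nth (negPf xc). Qed.

Lemma next_perm_closed (Z : {set 'I_n}) : Z \subset [set x in c] -> Z != set0 ->
  {in Z, forall i, next_perm i \in Z} -> Z = [set x in c].
Proof.
move=> Zc /set0Pn[z zZ] Zs; apply/eqP; rewrite eqEsubset Zc.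
have zc : z \in c by have := subsetP Zc z zZ; rewrite inE.
apply/subsetP => x; rewrite inE -(mem_traject_next c_cyc zc) => /trajectP[j _ ->].
by elim: j => //= j /Zs; rewrite permE.
Qed.

(** A finite set stable under the inverse permutation is mapped onto itself by it, hence is stable
    under the permutation too. *)
Lemma next_permV_closed (Z : {set 'I_n}) : Z \subset [set x in c] -> Z != set0 ->
  {in Z, forall i, (next_perm^-1)%g i \in Z} -> Z = [set x in c].
Proof.
move=> Zc Z0 Zs; apply: next_perm_closed => // x xZ.
have ZE : (next_perm^-1)%g @: Z = Z.
  apply/eqP; rewrite eqEcard card_imset ?leqnn ?andbT; last exact: perm_inj.
  by apply/subsetP => _ /imsetP[y /Zs yZ ->].
by move: xZ; rewrite -{1}ZE => /imsetP[y yZ ->]; rewrite permKV.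
Qed.

Lemma next_permV_in x : ((next_perm^-1)%g x \in c) = (x \in c).
Proof. by rewrite -{2}(permKV next_perm x) [in RHS]permE mem_next. Qed.

End CyclePermutation.

(** * Comparison of the bounds in the three cases *)

Theorem theorem4p13 (R : realType) (n : nat) (P : 'M[int]_n) (c : seq 'I_n)
    (P_sign : sign_pattern P)
    (P_irr : irreducible_pattern P)
    (P_sym : comb_symmetric P)
    (P_diag : zero_diagonal P)
    (c_unique : unique_cycle P c)
    (c_leaf : forall v : 'I_n, leaf P v -> ~~ odd (dist_to_cycle P c v)) :
  (exists E1 E2 : {set 'I_n},
      [/\ E1 \in cycle_edges c :&: pos_edges P,
          E2 \in cycle_edges c :&: pos_edges P
        & [disjoint E1 & E2] ])
  \/ (1 < #|[set S | maximal_signed_path P c S & odd #|S| ]|)%N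
  \/ (odd (size c) /\ exists E : {set 'I_n}, E \in cycle_edges c :&: pos_edges P)
  -> ~ consistent R P.
Proof.
move=> hyp [k' Ak].
have [c_cyc _] := c_unique.
have [E [O [f [dEO CE EO fO fi]]]] := off_cycle_matching P_irr P_sym P_diag c_unique c_leaf.
set m := (#|E| - #|O|)%N.
have mP (A : 'M[R]_n) : qual_class P A -> 'X^m %| char_poly A.
  move=> AP; apply: Xn_dvd_char_poly => // i iE j Aij; apply: (EO i iE).
  by rewrite -AP sgz_eq0.
pose C := [set x in c]; pose Op := #|[set x in O | 0 < P x (f x) * P (f x) x]|.
have NC x : x \in E :|: O -> x \notin c by rewrite -CE !inE.
(* D holds the initial vertices of disjoint positive edges of the cycle; the matching f on O is
   extended by [next c] on D. *)
have lower (D : {set 'I_n}) : {in D, forall x, x \in c /\ 0 < edge_sign P c x} ->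
    {in D, forall x, next c x \notin D} -> (m + 2 * (Op + #|D|) <= k')%N.
  move=> Dc Dn; pose g x := if x \in O then f x else next c x.
  have DO x : x \in D -> x \in O = false.
    by move=> /Dc[xc _]; apply: contraTF xc => xO; apply: NC; rewrite inE xO orbT.
  have DE x : x \in D -> x \notin E.
    by move=> /Dc[xc _]; apply: contraTN xc => xE; apply: NC; rewrite inE xE.
  have nxD x : x \in D -> next c x \notin E /\ next c x \notin O.
    move=> /Dc[xc _]; have nc : next c x \in c by rewrite mem_next.
    by split; apply: contraTN nc => h; apply: NC; rewrite inE h ?orbT.
  have := @consistent_lower_bound R n P P_sign P_diag P_sym k' m (O :|: D) g Ak mP.
  rewrite (_ : #|[set x in O :|: D | _]| = (Op + #|D|)%N); first apply.
  - move=> x y; rewrite !inE /g => /orP[xO|xD] /orP[yO|yD].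
    + by rewrite xO yO; apply: fi.
    + rewrite xO (DO y yD) => fxy; have [fE _] := fO x xO.
      by have [] := nxD y yD; rewrite -fxy fE.
    + rewrite yO (DO x xD) => fxy; have [fE _] := fO y yO.
      by have [] := nxD x xD; rewrite fxy fE.
    + by rewrite (DO x xD) (DO y yD) => /(cycle_next_inj c_cyc).
  - move=> x; rewrite !inE negb_or /g => /orP[xO|xD].
      have [fE _] := fO x xO; rewrite xO (disjointFr dEO fE) /=.
      by apply: contraTN fE => /DE.
    by rewrite (DO x xD) (Dn x xD) andbT; have [] := nxD x xD.
  - move=> x; rewrite !inE /g => /orP[xO|xD]; first by rewrite xO; have [] := fO x xO.
    by rewrite (DO x xD); have [xc _] := Dc x xD; have /andP[] := cycle_adj c_cyc xc.
  rewrite /Op -cardsUI (_ : _ :&: D = set0) ?cards0 ?addn0; last first.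
    by apply/setP => x; rewrite !inE; case: (boolP (x \in D)) => [/DO->|]; rewrite ?andbF.
  apply: eq_card => x; rewrite !inE /g.
  have [xD|_] := boolP (x \in D); last by rewrite !orbF; case: (x \in O).
  by rewrite !orbT (DO x xD); have [] := Dc x xD.
pose s := next_perm c_cyc.
have [x0 x0c] := cycle_nonempty c_unique.
have C0 : C != set0 by apply/set0Pn; exists x0; rewrite inE.
have cardC : #|C| = size c by rewrite cardsE; apply/card_uniqP/(cycle_uniq c_cyc).
have sP i : i \in c -> P i (s i) != 0.
  by move=> ic; rewrite permE; have /andP[] := cycle_adj c_cyc ic.
have sN i : i \in c -> s i != i.
  by move=> ic; rewrite permE; have [] := next_neq c_cyc ic.
have sVP i : i \in c -> P i ((s^-1)%g i) != 0.
  move=> ic; apply/P_sym; rewrite -{2}(permKV s i); apply: sP.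
  by rewrite next_permV_in.
have upper := consistent_upper_bound P_sign P_diag P_sym Ak dEO CE fO fi C0.
(* The same bound is taken for both orientations of the cycle, since the constants e may differ. *)
have upper1 : (k' <= (if odd (size c) then 1 else
          if ((-1) ^+ s * \prod_(i in C) - P i (s i) == 1)%R then 0 else 2) + (2 * Op + m))%N.
  rewrite -cardC; apply: upper.
  - by move=> i; rewrite inE; apply: sN.
  - by move=> i; rewrite !inE permE mem_next.
  - by move=> i; rewrite inE; apply: next_perm_out.
  - exact: next_perm_closed.
  - by move=> i; rewrite inE; apply: sP.
have upper2 : (k' <= (if odd (size c) then 1 else
          if ((-1) ^+ s * \prod_(i in C) - P i ((s^-1)%g i) == 1)%R then 0 else 2) + (2 * Op + m))%N.
  rewrite -cardC -odd_permV; apply: upper.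
  - move=> i; rewrite inE => ic; rewrite -{2}(permKV s i) eq_sym.
    by apply: sN; rewrite next_permV_in.
  - by move=> i; rewrite !inE next_permV_in.
  - move=> i; rewrite inE => ic; rewrite -{1}(next_perm_out c_cyc ic).
    exact: permK.
  - exact: next_permV_closed.
  - by move=> i; rewrite inE; apply: sVP.
have lower1 x : x \in c -> 0 < edge_sign P c x -> (m + 2 * (Op + 1) <= k')%N.
  move=> xc xp; have := @lower [set x]; rewrite cards1; apply => z; rewrite inE => /eqP-> //.
  by rewrite inE; have [] := next_neq c_cyc xc.
case: (cycle_trichotomy P_sign P_sym c_cyc hyp) =>
  [[x [y [xc yc xp yp dxy]]]|[ok [x xc xp]]|[ek [x [xc xp xN]]]].
- have xy : x != y.
    by apply: contraTneq dxy => ->; rewrite -setI_eq0 setIid; apply/set0Pn; exists y; rewrite set21.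
  have nx z u : z \in c -> [disjoint [set z; next c z] & [set u; next c u]] ->
      (next c z != z) && (next c z != u).
    move=> zc dzu; have [-> _] := next_neq c_cyc zc.
    apply: contraTneq dzu => zu; rewrite -setI_eq0; apply/set0Pn; exists u.
    by rewrite !inE zu eqxx orbT.
  have : (m + 2 * (Op + 2) <= k')%N.
    have := @lower [set x; y]; rewrite cards2 xy; apply => z; rewrite !inE => /orP[]/eqP-> //.
      by rewrite negb_or nx.
    by rewrite negb_or andbC nx // disjoint_sym.
  have : (k' <= 2 + (2 * Op + m))%N.
    by apply: leq_trans upper1 _; rewrite leq_add2r; case: ifP => // _; case: ifP.
  lia.
- by have := lower1 x xc xp; move: upper1; rewrite ok; lia.
have := lower1 x xc xp; move: upper1 upper2; rewrite (negPf ek).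
set e1 := _ * _; set e2 := _ * _.
(* The signs of s and its inverse cancel. Reindexing the second product by s pairs the two entries
   of each edge, which leaves the product of all edge signs. *)
have e12 : e1 * e2 = -1.
  rewrite /e1 /e2 mulrACA -expr2 sqrr_sign mul1r -(cycle_sign_prod P_sign P_sym c_cyc ek xc xp xN).
  rewrite [X in _ * X](reindex_inj (@perm_inj _ s)) /=.
  rewrite [X in _ * X](eq_bigl (mem C)) => [|i]; last by rewrite /= !inE permE mem_next.
  rewrite -big_split /=; apply: eq_big => [i|i _]; first by rewrite !inE.
  by rewrite permK permE mulrNN.
(* An orientation with constant 1 has no real root, so its upper bound is two below the lower
   bound. *)
have [e11|e1N] := eqVneq e1 1; first by lia.
have [e21|e2N] := eqVneq e2 1; first by lia.
(* The units of [int] are by definition 1 and -1. If [e1] is -1, then [e2] is 1, a value already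
   excluded. *)
have e_unit : (e1 == 1) || (e1 == -1).
  rewrite -[_ || _]/(e1 \is a GRing.unit).
  by apply/unitrPr; exists (- e2); rewrite mulrN e12 opprK.
move: e_unit; rewrite (negPf e1N) /= => /eqP e1E.
by move: e12 e2N; rewrite e1E mulN1r => /oppr_inj->.
Qed.
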